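(* Let $m\ge0$ and $\lambda,\mu$ partitions of $m$. There exists a unique $n_0\in N(m)$ such that $\langle\mathrm{ss}_{\lambda,n},\mathrm{ss}_{\mu,n}\rangle=0$ for all $n\in N(m)$ with $n<n_0$, and $\langle\mathrm{ss}_{\lambda,n},\mathrm{ss}_{\mu,n}\rangle>0$ for all $n\in N(m)$ with $n\ge n_0$.
   Context: $N(m)=\{n\ge m: n\equiv m\pmod 2\}$. $\langle\cdot,\cdot\rangle$ is the Hall inner product on homogeneous symmetric functions of degree $n$ (infinitely many variables), for which the Schur functions of degree $n$ are orthonormal. A skew shape is a horizontal strip if it has at most one box in each column. An SSOT of shape $\lambda$ is a sequence of partitions $S=(S^1,S'^2,S^2,S'^3,\dots)$ such that, with $S^0=S'^1=\emptyset$: for all $i\ge1$, $S'^i\subseteq S^{i-1}$, $S'^i\subseteq S^i$, and $S^{i-1}/S'^i$, $S^i/S'^i$ are horizontal strips (possibly empty); and $S^i=S'^{i+1}=\lambda$ for all large $i$. Put $m_i(S)=|S^{i-1}/S'^i|+|S^i/S'^i|$, length $n=\sum_i m_i(S)$, $x^S=\prod_ix_i^{m_i(S)}$. $\mathrm{ss}_{\lambda,n}(x)=\sum x^S$ over SSOTs of shape $\lambda$ and length $n$; it is a homogeneous symmetric function of degree $n$. *)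

(* Defs.v *)
From HB Require Import structures.
From mathcomp Require Import all_boot all_order all_algebra finmap.
From mathcomp Require Import mathcomp_extra boolp classical_sets functions.
From mathcomp Require Import cardinality fsbigop.

Set Implicit Arguments.
Unset Strict Implicit.
Unset Printing Implicit Defensive.
Import Order.TTheory GRing.Theory Num.Theory.
Local Open Scope classical_set_scope.
Local Open Scope ring_scope.

(* The parts of a partition are listed without trailing zeros, so that equality
   of lists is equality of partitions. *)
Definition is_intpart (s : seq nat) : bool := sorted geq s && (0%N \notin s).

Record intpart := IntPart { parts :> seq nat; _ : is_intpart parts }.

HB.instance Definition _ := [isSub for parts].
HB.instance Definition _ := [Countable of intpart by <:].

Definition part0 : intpart := @IntPart [::] isT.

Definition psize (nu : intpart) : nat := sumn nu.

(* Rows and columns are numbered from 0; part nu i is 0 beyond the last row. *)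
Definition part (nu : intpart) (i : nat) : nat := nth 0%N nu i.

Definition part_incl (mu nu : intpart) : Prop :=
  forall i, (part mu i <= part nu i)%N.

Definition skew_box (nu mu : intpart) (i j : nat) : bool :=
  (part mu i <= j < part nu i)%N.

Definition skew_size (nu mu : intpart) : nat := (psize nu - psize mu)%N.

(* nu / mu is a skew shape and has at most one box in each column. *)
Definition horizontal_strip (nu mu : intpart) : Prop :=
  part_incl mu nu /\
  forall j i i', skew_box nu mu i j -> skew_box nu mu i' j -> i = i'.

(* Formal power series with rational coefficients in countably many variables
   x_0, x_1, ...: the exponent vector alpha stands for the monomial
   \prod_i x_i ^+ alpha i. *)
Notation expvec := {fsfun nat -> nat with 0%N}.
Definition powser : Type := expvec -> rat.

(* For a partition nu, a semistandard Young tableau of shape nu given by the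
   list of its rows; the entry i contributes a factor x_i. *)
Definition is_ssyt (nu : intpart) (T : seq (seq nat)) : Prop :=
  [/\ map size T = parts nu,
      all (sorted leq) T
    & forall i j, (i.+1 < size T)%N -> (j < size (nth [::] T i.+1))%N ->
        (nth 0%N (nth [::] T i) j < nth 0%N (nth [::] T i.+1) j)%N].

Definition schur (nu : intpart) : powser := fun alpha =>
  #|` fset_set [set T : seq (seq nat) |
        is_ssyt nu T /\ forall i, count_mem i (flatten T) = alpha i] |%:R.

Definition is_schur_expansion (n : nat) (f : powser) (c : intpart -> rat) :
    Prop :=
  forall alpha, f alpha =
    \sum_(nu \in [set nu : intpart | psize nu = n]) c nu * schur nu alpha.

(* The Schur functions of degree n form a basis of the space of homogeneous
   symmetric functions of degree n; schur_coef n f nu is the coordinate of f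
   on schur nu for psize nu = n, and 0 if f is outside that space. *)
Definition schur_coef (n : nat) (f : powser) : intpart -> rat :=
  xget (fun=> 0) [set c | is_schur_expansion n f c].

(* The bilinear form on homogeneous symmetric functions of degree n for which
   the Schur functions of degree n are orthonormal. *)
Definition hall (n : nat) (f g : powser) : rat :=
  \sum_(nu \in [set nu : intpart | psize nu = n])
     schur_coef n f nu * schur_coef n g nu.

(* A pair S of sequences encodes (S^1, S'^2, S^2, ...), with S^0 and S'^1 made
   explicit: S.1 i is S^i and, with a shift of index, S.2 i is S'^(i+1).
   Condition S'^1 = \emptyset follows from part_incl (S.2 0) (S.1 0). *)
Definition ssot_seq : Type := (nat -> intpart) * (nat -> intpart).

Definition is_ssot (lam : intpart) (S : ssot_seq) : Prop :=
  [/\ S.1 0%N = part0,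
      forall i, horizontal_strip (S.1 i) (S.2 i),
      forall i, horizontal_strip (S.1 i.+1) (S.2 i)
    & exists N, forall i, (N <= i)%N -> S.1 i = lam /\ S.2 i = lam].

(* ssot_mult S i is m_(i+1)(S), the exponent in x^S of the variable numbered i
   when the variables are numbered from 0. *)
Definition ssot_mult (S : ssot_seq) (i : nat) : nat :=
  (skew_size (S.1 i) (S.2 i) + skew_size (S.1 i.+1) (S.2 i))%N.

(* A sum over all of nat: finitely many terms are nonzero when S is an SSOT. *)
Definition ssot_length (S : ssot_seq) : nat :=
  \sum_(i \in [set: nat]) ssot_mult S i.

Definition ss (lam : intpart) (n : nat) : powser := fun alpha =>
  #|` fset_set [set S : ssot_seq |
        [/\ is_ssot lam S, ssot_length S = n
          & forall i, ssot_mult S i = alpha i]] |%:R.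

Definition parity_tail (m : nat) : set nat :=
  [set n | (m <= n)%N /\ n = m %[mod 2]].

(* Main.v *)
Require Import Defs.
From HB Require Import structures.
From mathcomp Require Import all_boot all_order all_algebra all_fingroup finmap.
From mathcomp Require Import mpoly zify.
From mathcomp Require Import mathcomp_extra boolp classical_sets functions.
From mathcomp Require Import cardinality fsbigop.

Set Implicit Arguments.
Unset Strict Implicit.
Unset Printing Implicit Defensive.
Import Order.TTheory GRing.Theory Num.Theory.
Local Open Scope classical_set_scope.
Local Open Scope ring_scope.

(* In N variables, removing and adding horizontal strips commute up to the
   factor 1 / (1 - x y), so SSOTs of shape lam are generated by
   s_lam * \prod_(i < j) 1 / (1 - x_i x_j), and the product is the sum of the s_de
   over the partitions de with columns of even length. Stembridge's sign-reversing
   involution gives a_(de + rho) s_lam = \sum_T a_(de + wt T + rho), where T runs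
   over the tableaux of shape lam such that de + wt (T restricted to columns >= j)
   is a partition for all j. Hence the coefficient of s_nu in ss_(lam, n) is the
   number of such pairs (de, T) with de + wt T = nu, and the inner product is
   nonnegative; it is positive as soon as some nu has both coefficients positive.
   Adding (1, 1) to de and nu preserves the condition on T, so positivity passes
   from n to n + 2. It does occur: with de = (m, m, m-1, m-1, .., 1, 1), a standard
   tableau of any shape of size m on the letters 0, 2, .., 2m-2 is admissible and
   leads to the same nu. *)

(** The Hall product is defined through coordinates that are merely chosen, for series in infinitely
    many variables, so it can be computed only once Schur expansions are known to be unique. This is
    done with polynomials in N variables, N at least the degree n: every partition of n then has at
    most N rows, and after multiplication by the alternant a_rho the coefficient of x^(nu + rho)
    isolates s_nu. Independence also shows that the coefficients do not depend on N, which can thus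
    be enlarged to compare two degrees or to make room for a tableau.

    The involution is used twice: with de = 0 it yields the bialternant formula, which turns the
    alternants of the general case back into Schur polynomials.

    A partition with even columns has even size, whence the parity condition. For a common nu, one
    de and one weight must serve every shape of size m. A single column only admits weights with
    entries 0 and 1, so the tableaux are standard; spreading their letters over every other row of
    de meets the condition on columns whatever the positions of the boxes. *)

Lemma big_bij (R : nmodType) (I J : eqType) (r1 : seq I) (r2 : seq J)
    (P1 : pred I) (P2 : pred J) (F1 : I -> R) (F2 : J -> R)
    (f : I -> J) (g : J -> I) :
  uniq r1 -> uniq r2 ->
  (forall x, x \in r1 -> P1 x ->
     [/\ f x \in r2, P2 (f x), g (f x) = x & F2 (f x) = F1 x]) ->
  (forall y, y \in r2 -> P2 y -> [/\ g y \in r1, P1 (g y) & f (g y) = y]) ->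
  \sum_(x <- r1 | P1 x) F1 x = \sum_(y <- r2 | P2 y) F2 y.
Proof.
move=> u1 u2 hf hg; rewrite -big_filter -[RHS]big_filter.
have -> : \sum_(x <- [seq x <- r1 | P1 x]) F1 x =
          \sum_(y <- [seq f x | x <- [seq x <- r1 | P1 x]]) F2 y.
  rewrite big_map; apply: eq_big_seq => x; rewrite mem_filter => /andP[px xr].
  by have [_ _ _ ->] := hf x xr px.
apply/perm_big/uniq_perm; rewrite ?filter_uniq //.
  rewrite map_inj_in_uniq ?filter_uniq // => x y.
  rewrite !mem_filter => /andP[px xr] /andP[py yr] e.
  by have [_ _ <- _] := hf x xr px; have [_ _ <- _] := hf y yr py; rewrite e.
move=> y; rewrite mem_filter; apply/mapP/andP => [[x]|[py yr]].
  by rewrite mem_filter => /andP[px xr] ->; have [] := hf x xr px.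
have [gr gp e] := hg y yr py; exists (g y) => //.
by rewrite mem_filter gp.
Qed.

Lemma eq_big_range (R : nmodType) (I : eqType) (r1 r2 : seq I)
    (P1 P2 : pred I) (F : I -> R) :
  uniq r1 -> uniq r2 ->
  (forall x, (x \in r1) && P1 x = (x \in r2) && P2 x) ->
  \sum_(x <- r1 | P1 x) F x = \sum_(x <- r2 | P2 x) F x.
Proof.
move=> u1 u2 e; apply: (big_bij (f := id) (g := id)) => // x xr px.
  by have := e x; rewrite xr px => /esym/andP[-> ->].
by have := e x; rewrite xr px => /andP[-> ->].
Qed.

Lemma sum_point (R : nmodType) (I : eqType) (r : seq I) (P : pred I)
    (F : I -> R) x :
  uniq r -> (forall y, (y \in r) && P y = (y == x)) ->
  \sum_(y <- r | P y) F y = F x.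
Proof.
move=> u e; rewrite (@eq_big_range _ _ _ [:: x] _ xpredT) ?big_seq1 //.
by move=> y; rewrite e inE andbT.
Qed.

(** A transposition of distant points is conjugate, by an adjacent one, to a transposition of points
    one step closer. Adjacent generators are what the Bender-Knuth involution provides. *)
Lemma perm_tperm_ind (n : nat) (Q : {perm 'I_n} -> Prop) :
  Q 1%g -> (forall s t, Q s -> Q t -> Q (s * t)%g) ->
  (forall i j : 'I_n, j = i.+1 :> nat -> Q (tperm i j)) ->
  forall s, Q s.
Proof.
move=> Q1 QM Qadj.
have Qlt d : forall i j : 'I_n, j = (i + d.+1)%N :> nat -> Q (tperm i j).
  elim: d => [|d IH] i j ij; first by apply: Qadj; rewrite ij addn1.
  have kn : (i.+1 < n)%N by have := ltn_ord j; lia.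
  pose k := Ordinal kn.
  have -> : tperm i j = (tperm i k * tperm k j * tperm i k)%g.
    have := tpermJ k j (tperm i k); rewrite tpermR tpermD; first last.
    - by apply/eqP => /(congr1 val) /=; lia.
    - by apply/eqP => /(congr1 val) /=; lia.
    by move=> <-; rewrite /conjg tpermV mulgA.
  apply: (QM) (Qadj _ _ _) => //; apply: QM; first exact: Qadj.
  by apply: IH => /=; lia.
have Qt (i j : 'I_n) : Q (tperm i j).
  have [ij|ij|/val_inj->] := ltngtP i j; last by rewrite tperm1.
    by apply: (Qlt (j - i.+1)%N); lia.
  by rewrite tpermC; apply: (Qlt (i - j.+1)%N); lia.
move=> s; have [ts -> _] := prod_tpermP s.
elim: ts => [|t ts IH]; first by rewrite big_nil.
by rewrite big_cons; apply: QM.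
Qed.

(** * Partitions and horizontal strips *)

Lemma part_ext (mu nu : intpart) : part mu =1 part nu -> mu = nu.
Proof.
have lt_size (a b : intpart) : part a =1 part b -> (size b <= size a)%N.
  move=> e; rewrite leqNgt; apply/negP => lt_ab.
  have /andP[_] := valP b; have := mem_nth 0%N lt_ab.
  by rewrite -[nth _ _ _]/(part b (size a)) -e /part nth_default // => ->.
move=> e; apply: val_inj; apply: (@eq_from_nth _ 0%N) => [|i _]; last exact: e.
by apply/eqP; rewrite eqn_leq !lt_size // => i; rewrite e.
Qed.

Lemma part_default (nu : intpart) i : (size nu <= i)%N -> part nu i = 0%N.
Proof. exact: nth_default. Qed.

Lemma leq_part (nu : intpart) i j : (i <= j)%N -> (part nu j <= part nu i)%N.
Proof.
move=> ij; have [sj|js] := leqP (size nu) j; first by rewrite part_default.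
have /andP[snu _] := valP nu.
have [->//|ne] := eqVneq i j.
apply: (sorted_ltn_nth (leT := geq)) => //.
- by move=> a b c /= ba cb; apply: leq_trans cb ba.
- exact: leq_ltn_trans ij js.
- by rewrite ltn_neqAle ne.
Qed.

Lemma partS (nu : intpart) i : (part nu i.+1 <= part nu i)%N.
Proof. exact: leq_part. Qed.

(** The list is cut at the first zero of [f] to avoid trailing zeros; [L] only bounds the search.
    Since [insubd] falls back on [part0], monotonicity of [f] has to be proved before the parts can
    be read off. *)
Definition mkpart (f : nat -> nat) (L : nat) : intpart :=
  insubd part0 (mkseq f (find (fun i => f i == 0%N) (iota 0 L))).

Lemma part_mkpart (f : nat -> nat) L :
  (forall i, (f i.+1 <= f i)%N) -> f L = 0%N -> part (mkpart f L) =1 f.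
Proof.
move=> fS fL.
have fle i j : (i <= j)%N -> (f j <= f i)%N.
  move=> /subnKC <-; elim: (j - i)%N => [|d IH]; rewrite ?addn0 //.
  by rewrite addnS (leq_trans (fS _)).
rewrite /mkpart; set k := find _ _.
have kL : (k <= L)%N by rewrite -[leqRHS](size_iota 0) find_size.
have lek i : (k <= i)%N -> f i = 0%N.
  move=> ki; apply/eqP; rewrite -leqn0 (leq_trans (fle _ _ ki)) //.
  have [kL'|Lk] := ltnP k L; last by rewrite -fL fle.
  have := kL'; rewrite -[ltnRHS](size_iota 0) -has_find.
  by move=> /(nth_find 0%N) /eqP; rewrite -/k nth_iota // => ->.
have ltk i : (i < k)%N -> f i != 0%N.
  move=> ik; have iL : (i < L)%N by apply: leq_trans kL.
  by have := before_find 0%N ik; rewrite nth_iota // => ->.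
have ok : is_intpart (mkseq f k).
  apply/andP; split; last first.
    by apply/mapP => -[i]; rewrite mem_iota /= add0n => /ltk /eqP ne e; apply: ne.
  apply/(sortedP 0%N) => i; rewrite size_mkseq => ik.
  by rewrite !nth_mkseq ?(ltnW ik) //; apply: fS.
move=> i; rewrite /part insubdK //.
have [ik|ki] := ltnP i k; first by rewrite nth_mkseq.
by rewrite nth_default ?size_mkseq // lek.
Qed.

Lemma psizeE (nu : intpart) L :
  part nu L = 0%N -> psize nu = (\sum_(i < L) part nu i)%N.
Proof.
move=> nuL; have le : (size nu <= L)%N.
  rewrite leqNgt; apply/negP => lt; have /andP[_] := valP nu.
  by have := mem_nth 0%N lt; rewrite -[nth _ _ _]/(part nu L) nuL => ->.
rewrite /psize sumnE (big_nth 0%N) -(big_mkord xpredT (part nu)).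
rewrite (@big_cat_nat _ _ _ (size nu) 0 L) //= [X in (_ + X)%N]big1_seq ?addn0 //.
by move=> i /=; rewrite mem_index_iota => /andP[/part_default].
Qed.

Lemma psize0 : psize part0 = 0%N. Proof. by []. Qed.

Lemma part_part0 i : part part0 i = 0%N.
Proof. by rewrite /part nth_nil. Qed.

Lemma leq_part_psize (nu : intpart) i : (part nu i <= psize nu)%N.
Proof.
have [ni|ni] := leqP (size nu) i; first by rewrite part_default.
rewrite (psizeE (part_default (leqnn _))).
by rewrite (bigD1 (Ordinal ni)) //= leq_addr.
Qed.

Lemma size_leq_psize (nu : intpart) : (size nu <= psize nu)%N.
Proof.
rewrite (psizeE (part_default (leqnn _))).
rewrite -[leqLHS](card_ord (size nu)) -sum1_card leq_sum // => i _.
rewrite lt0n; apply/eqP => e; have /andP[_] := valP nu.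
by have := mem_nth 0%N (ltn_ord i); rewrite -[nth _ _ _]/(part nu i) e => ->.
Qed.

Lemma part_psize (nu : intpart) i : (psize nu <= i)%N -> part nu i = 0%N.
Proof. by move=> le; rewrite part_default // (leq_trans (size_leq_psize _)). Qed.

Lemma psize_eq0 (nu : intpart) : psize nu = 0%N -> nu = part0.
Proof.
move=> nu0; apply: part_ext => i; rewrite part_part0.
by apply/eqP; rewrite -leqn0 -nu0 leq_part_psize.
Qed.

Lemma finite_psize_le d : finite_set [set nu : intpart | (psize nu <= d)%N].
Proof.
pose F (f : {ffun 'I_d -> 'I_d.+1}) :=
  mkpart (fun i => if insub i is Some j then f j : nat else 0%N) d.
apply: (sub_finite_set _ (finite_image F (@finite_finset _ [set: _]))).
move=> nu /= nud; exists [ffun i : 'I_d => inord (part nu i)] => //.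
have e i : (if insub i is Some j
    then [ffun i : 'I_d => (inord (part nu i) : 'I_d.+1)] j : nat else 0%N)
    = part nu i.
  case: insubP => [j _ <-|]; last first.
    by rewrite -leqNgt => /(leq_trans nud)/part_psize->.
  by rewrite ffunE inordK // ltnS (leq_trans (leq_part_psize _ _)).
apply: part_ext => i; rewrite part_mkpart ?e //; last exact: part_psize.
by move=> k; rewrite !e partS.
Qed.

Lemma finite_psize d : finite_set [set nu : intpart | psize nu = d].
Proof. by apply: sub_finite_set (finite_psize_le d) => nu /= ->. Qed.

Definition parts_of (d : nat) : seq intpart :=
  fset_set [set nu : intpart | psize nu = d].
Definition parts_le (d : nat) : seq intpart :=
  fset_set [set nu : intpart | (psize nu <= d)%N].

Lemma mem_parts_of d nu : (nu \in parts_of d) = (psize nu == d).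
Proof.
rewrite [LHS](in_fset_set (finite_psize d)); apply/idP/eqP.
  by rewrite inE.
by move=> e; rewrite inE.
Qed.

Lemma mem_parts_le d nu : (nu \in parts_le d) = (psize nu <= d)%N.
Proof.
rewrite [LHS](in_fset_set (finite_psize_le d)).
by apply/idP/idP; rewrite inE.
Qed.

Lemma uniq_parts_of d : uniq (parts_of d). Proof. exact: fset_uniq. Qed.
Lemma uniq_parts_le d : uniq (parts_le d). Proof. exact: fset_uniq. Qed.

Definition hstrip (nu mu : intpart) : bool :=
  `[< forall i, (part mu i <= part nu i)%N /\ (part nu i.+1 <= part mu i)%N >].

Lemma hstripP nu mu :
  reflect (forall i, (part mu i <= part nu i)%N /\
                     (part nu i.+1 <= part mu i)%N) (hstrip nu mu).
Proof. exact: asboolP. Qed.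

Lemma horizontal_stripE nu mu : horizontal_strip nu mu <-> hstrip nu mu.
Proof.
split=> [[le box]|/hstripP h].
  apply/hstripP => i; split; first exact: le.
  rewrite leqNgt; apply/negP => lt.
  (* If row [i.+1] of [nu] were longer than row [i] of [mu], column [part mu i] would contain boxes
     in both rows. *)
  have := box (part mu i) i i.+1; rewrite /skew_box leqnn lt partS /=.
  by move=> /(_ (leq_trans lt (partS nu i)) isT) /eqP; rewrite -{1}[i]addn0 -addn1 eqn_add2l.
split=> [i|j]; first by have [] := h i.
have wlog (i i' : nat) : (i < i')%N -> skew_box nu mu i j -> skew_box nu mu i' j -> False.
  move=> lt /andP[a _] /andP[_ b]; have [_ c] := h i.
  by have := leq_part nu lt; lia.
move=> i i' hi hi'; have [lt|lt|//] := ltngtP i i'; exfalso.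
  exact: wlog lt hi hi'.
exact: wlog lt hi' hi.
Qed.

Lemma hstrip_psize nu mu : hstrip nu mu -> (psize mu <= psize nu)%N.
Proof.
move=> /hstripP h; rewrite [leqRHS](psizeE (part_psize (leq_addr (psize mu) _))).
rewrite [leqLHS](psizeE (part_psize (leq_addl (psize nu) _))).
by apply: leq_sum => i _; have [] := h i.
Qed.

Lemma hstrip_refl nu : hstrip nu nu.
Proof. by apply/hstripP => i; split => //; apply: partS. Qed.

Lemma leq_psize_eq (mu nu : intpart) :
  (forall i, (part mu i <= part nu i)%N) -> psize mu = psize nu -> mu = nu.
Proof.
move=> le; rewrite [LHS](psizeE (part_psize (leq_addl (psize nu) _))).
rewrite [RHS](psizeE (part_psize (leq_addr (psize mu) _))) => e; apply: part_ext => i.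
have [ge|lt] := leqP (psize nu + psize mu) i.
  by rewrite !part_psize //; apply: leq_trans ge; rewrite ?leq_addr ?leq_addl.
have /leqif_sum := fun (i : 'I_(psize nu + psize mu)) (_ : xpredT i) =>
  conj (le i) (erefl (part mu i == part nu i)) : (_ <= _ ?= iff _)%N.
by move=> [_]; rewrite e eqxx => /esym/forallP/(_ (Ordinal lt)) /eqP.
Qed.

(** Serves to sort a sum over partitions by the size of a strip, where the statistic [p] may involve
    truncated subtraction. *)
Lemma partition_seq (R : nmodType) (I : eqType) (r : seq I) (P : pred I)
    (F : I -> R) K (Q : pred 'I_K) (ra : 'I_K -> seq I)
    (Pa : 'I_K -> pred I) (p : I -> nat) :
  uniq r -> (forall a, uniq (ra a)) ->
  (forall y, y \in r -> P y -> (p y < K)%N) ->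
  (forall (a : 'I_K) y, [&& y \in r, P y & p y == a :> nat] = [&& Q a, y \in ra a & Pa a y]) ->
  \sum_(y <- r | P y) F y = \sum_(a | Q a) \sum_(y <- ra a | Pa a y) F y.
Proof.
move=> ur ura pK e.
have -> : \sum_(a | Q a) \sum_(y <- ra a | Pa a y) F y =
          \sum_(a < K) \sum_(y <- r | P y && (p y == a)) F y.
  rewrite big_mkcond; apply: eq_bigr => a _; case: ifPn => Qa.
    by apply: eq_big_range => // y; rewrite e Qa.
  rewrite big_seq_cond big1 // => y; rewrite e (negbTE Qa) //.
rewrite (exchange_big_dep P) //=; last by move=> ? ? _ /andP[].
rewrite [LHS]big_seq_cond [RHS]big_seq_cond; apply: eq_bigr => y /andP[yr Py].
rewrite (big_pred1 (Ordinal (pK y yr Py))) // => a.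
by rewrite Py /= eq_sym; apply/eqP/eqP => [eq|->//]; apply: val_inj.
Qed.

(** Sum the hypothesis over all rows and use min + max = [de] + [mu]: the shifted maxima miss only
    row 0, and so do the shifted rows of [ka]. *)
Lemma toggle_psize (de mu ka ta : intpart) :
  (forall i, part ta i + part ka i.+1 = minn (part de i) (part mu i) +
                           maxn (part de i.+1) (part mu i.+1))%N ->
  (psize ta + psize ka + maxn (part de 0) (part mu 0) =
   part ka 0 + psize de + psize mu)%N.
Proof.
move=> e; pose L := (psize de + psize mu + psize ka + psize ta)%N.
have z nu : (psize nu <= L)%N -> part nu L = 0%N by apply: part_psize.
have zd : part de L = 0%N by apply: z; lia.
have zm : part mu L = 0%N by apply: z; lia.
have zt : part ta L = 0%N by apply: z; lia.
have zk : part ka L.+1 = 0%N by apply: part_psize; lia.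
have E1 : (\sum_(i < L) part ta i + \sum_(i < L) part ka i.+1 =
           \sum_(i < L) minn (part de i) (part mu i) +
           \sum_(i < L) maxn (part de i.+1) (part mu i.+1))%N.
  by rewrite -!big_split /=; apply: eq_bigr => i _.
have E2 : psize ka = (part ka 0 + \sum_(i < L) part ka i.+1)%N.
  by rewrite (psizeE zk) big_ord_recl.
have E3 : (maxn (part de 0) (part mu 0) +
    \sum_(i < L) maxn (part de i.+1) (part mu i.+1) =
    \sum_(i < L) maxn (part de i) (part mu i))%N.
  have <- : (\sum_(i < L.+1) maxn (part de i) (part mu i) =
      \sum_(i < L) maxn (part de i) (part mu i))%N.
    by rewrite big_ord_recr /= zd zm maxnn addn0.
  by rewrite big_ord_recl.
have E4 : (\sum_(i < L) minn (part de i) (part mu i) +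
    \sum_(i < L) maxn (part de i) (part mu i) = psize de + psize mu)%N.
  rewrite (psizeE zd) (psizeE zm) -!big_split /=.
  by apply: eq_bigr => i _; rewrite addn_min_max.
by rewrite (psizeE zt); lia.
Qed.

(* The local rule of the growth diagram: with [min] and [max] taken between
   [de] and [mu], the lower partition is [ta_i = min_i + max_(i+1) - ka_(i+1)],
   and the first row of [ka], which has no upper bound, is recovered from its
   size. *)
Lemma strip_commute (V : nmodType) (c : V) (de mu : intpart) D :
  \sum_(ka <- parts_of D | hstrip ka de && hstrip ka mu) c =
  \sum_(ta <- parts_le (psize de) | [&& hstrip de ta, hstrip mu ta &
        (psize de + psize mu <= psize ta + D)%N]) c.
Proof.
pose L := (psize de + psize mu)%N.
pose mn i := minn (part de i) (part mu i).
pose mx i := maxn (part de i) (part mu i).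
pose f ka := mkpart (fun i => mn i + mx i.+1 - part ka i.+1)%N L.
(* Row 0 solves [toggle_psize] for [part ka 0]. The inequality on sizes in the right-hand sum makes
   the truncated subtraction exact and says that this row is at least [mx 0]. *)
pose gf (ta : intpart) i := if i is j.+1 then (mn j + mx j.+1 - part ta j)%N
                else (mx 0 + (psize ta + D - L))%N.
pose g ta := mkpart (gf ta) L.+1.
have mnL : mn L = 0%N by rewrite /mn part_psize ?min0n // /L leq_addr.
have mxL i : (L <= i)%N -> mx i = 0%N.
  by move=> Li; rewrite /mx !part_psize // (leq_trans _ Li) // /L; lia.
have fE ka : hstrip ka de -> hstrip ka mu ->
    forall i, part (f ka) i = (mn i + mx i.+1 - part ka i.+1)%N.
  move=> /hstripP h1 /hstripP h2; apply: part_mkpart => [i|].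
    have [a1 a2] := h1 i.+1; have [b1 b2] := h2 i.+1.
    have [c1 c2] := h1 i; have [d1 d2] := h2 i.
    have [e1 e2] := h1 i.+2; have [f1 f2] := h2 i.+2.
    rewrite /mn /mx; lia.
  by rewrite mnL mxL.
have gE ta : hstrip de ta -> hstrip mu ta -> forall i, part (g ta) i = gf ta i.
  move=> /hstripP h1 /hstripP h2; apply: part_mkpart => [[|i]|].
  - have [a1 a2] := h1 0%N; have [b1 b2] := h2 0%N.
    by rewrite /gf /mn /mx; lia.
  - have [a1 a2] := h1 i.+1; have [b1 b2] := h2 i.+1.
    have [c1 c2] := h1 i; have [d1 d2] := h2 i.
    by rewrite /gf /mn /mx; lia.
  by rewrite /gf mnL mxL.
apply: (big_bij (f := f) (g := g)); rewrite ?uniq_parts_of ?uniq_parts_le //.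
  move=> ka; rewrite mem_parts_of => /eqP kD /andP[h1 h2].
  have e i : (part (f ka) i + part ka i.+1 = mn i + mx i.+1)%N.
    rewrite fE //; have [_ a] := hstripP _ _ h1 i; have [_ b] := hstripP _ _ h2 i.
    by rewrite /mn /mx; lia.
  have sz := toggle_psize e.
  have hd : hstrip de (f ka).
    apply/hstripP => i; have := e i.
    have [a1 a2] := hstripP _ _ h1 i; have [b1 b2] := hstripP _ _ h2 i.
    have [a3 a4] := hstripP _ _ h1 i.+1; have [b3 b4] := hstripP _ _ h2 i.+1.
    by rewrite /mn /mx; lia.
  have hm : hstrip mu (f ka).
    apply/hstripP => i; have := e i.
    have [a1 a2] := hstripP _ _ h1 i; have [b1 b2] := hstripP _ _ h2 i.
    have [a3 a4] := hstripP _ _ h1 i.+1; have [b3 b4] := hstripP _ _ h2 i.+1.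
    by rewrite /mn /mx; lia.
  have [a1 _] := hstripP _ _ h1 0%N; have [b1 _] := hstripP _ _ h2 0%N.
  split => //; first by rewrite mem_parts_le hstrip_psize.
    by rewrite hd hm /=; lia.
  apply: part_ext => i; rewrite gE //; case: i => [|i] /=.
    by rewrite /mx /L; lia.
  by have := e i; rewrite /mn /mx; lia.
move=> ta; rewrite mem_parts_le => le /and3P[h1 h2 leD].
have e i : (part ta i + part (g ta) i.+1 = mn i + mx i.+1)%N.
  rewrite gE //=; have [a _] := hstripP _ _ h1 i; have [b _] := hstripP _ _ h2 i.
  by rewrite /mn /mx; lia.
have sz := toggle_psize e.
have g0 := gE ta h1 h2 0%N; rewrite /= /L in g0.
have hd : hstrip (g ta) de.
  apply/hstripP => -[|i].
    have := e 0%N; have [a1 a2] := hstripP _ _ h1 0%N.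
    have [b1 b2] := hstripP _ _ h2 0%N.
    by rewrite g0 /mn /mx; lia.
  have := e i; have := e i.+1.
  have [a1 a2] := hstripP _ _ h1 i; have [b1 b2] := hstripP _ _ h2 i.
  have [a3 a4] := hstripP _ _ h1 i.+1; have [b3 b4] := hstripP _ _ h2 i.+1.
  by rewrite /mn /mx; lia.
have hm : hstrip (g ta) mu.
  apply/hstripP => -[|i].
    have := e 0%N; have [a1 a2] := hstripP _ _ h1 0%N.
    have [b1 b2] := hstripP _ _ h2 0%N.
    by rewrite g0 /mn /mx; lia.
  have := e i; have := e i.+1.
  have [a1 a2] := hstripP _ _ h1 i; have [b1 b2] := hstripP _ _ h2 i.
  have [a3 a4] := hstripP _ _ h1 i.+1; have [b3 b4] := hstripP _ _ h2 i.+1.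
  by rewrite /mn /mx; lia.
split; rewrite ?hd ?hm //.
  by rewrite mem_parts_of; apply/eqP; rewrite /mx in g0; lia.
by apply: part_ext => i; rewrite fE //; have := e i; lia.
Qed.

(** Equality of rows 2i and 2i+1 for all i means that every column has even length. *)
Definition paired (de : intpart) : bool :=
  `[< forall i, part de i.*2 = part de i.*2.+1 >].

Lemma pairedP de :
  reflect (forall i, part de i.*2 = part de i.*2.+1) (paired de).
Proof. exact: asboolP. Qed.

Lemma paired_half de i : paired de -> part de i = part de i./2.*2.
Proof.
move=> /pairedP e; rewrite -{1}[i]odd_double_half.
by case: (odd i); rewrite //= add1n e.
Qed.

(* Above and below [ka] there is exactly one partition with columns of even
   length at the distance of a horizontal strip, and both strips have the same
   size. *)
Lemma paired_strip (V : nmodType) (c : V) (ka : intpart) a :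
  \sum_(de <- parts_of (psize ka + a) | paired de && hstrip de ka) c =
  \sum_(ep <- parts_le (psize ka) | [&& paired ep, hstrip ka ep &
        (psize ep + a == psize ka)%N]) c.
Proof.
pose L := (psize ka).*2.
(* Interlacing squeezes a pair of equal rows: above [ka] it lies between two copies of
   [part ka i.*2], below [ka] between two copies of [part ka i.*2.+1]. *)
pose up := mkpart (fun i => part ka i./2.*2) L.
pose dn := mkpart (fun i => part ka i./2.*2.+1) L.
have upE : part up =1 (fun i => part ka i./2.*2).
  apply: part_mkpart => [i|]; first by apply: leq_part; lia.
  by rewrite /L doubleK part_psize //; lia.
have dnE : part dn =1 (fun i => part ka i./2.*2.+1).
  apply: part_mkpart => [i|]; first by apply: leq_part; lia.
  by rewrite /L doubleK part_psize //; lia.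
have up_pair : paired up by apply/pairedP => i; rewrite !upE; congr part; lia.
have dn_pair : paired dn by apply/pairedP => i; rewrite !dnE; congr part; lia.
have hup : hstrip up ka.
  by apply/hstripP => i; rewrite !upE; split; apply: leq_part; lia.
have hdn : hstrip ka dn.
  by apply/hstripP => i; rewrite !dnE; split; apply: leq_part; lia.
have usz : (psize up + psize dn = (psize ka).*2)%N.
  have kL : part ka L = 0%N by apply: part_psize; rewrite /L; lia.
  rewrite (psizeE kL) (@psizeE up L) ?upE; last first.
    by rewrite /L doubleK -/L kL.
  rewrite (@psizeE dn L) ?dnE; last first.
    by rewrite /L doubleK -/L; apply: part_psize; rewrite /L; lia.
  rewrite -big_split /= /L; elim: (psize ka) => [|d IH].
    by rewrite !big_ord0.
  rewrite doubleS !big_ord_recr /= !doubleD -!IH !upE !dnE.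
  by rewrite /= uphalf_double doubleK; lia.
have upU de : paired de -> hstrip de ka -> de = up.
  move=> pd /hstripP h; apply: part_ext => i; rewrite upE (paired_half i pd).
  have [a1 a2] := h i./2.*2; have := pairedP _ pd i./2; lia.
have dnU ep : paired ep -> hstrip ka ep -> ep = dn.
  move=> pd /hstripP h; apply: part_ext => i; rewrite dnE (paired_half i pd).
  have [a1 a2] := h i./2.*2; have [b1 b2] := h i./2.*2.+1.
  have := pairedP _ pd i./2; lia.
apply: (big_bij (f := fun=> dn) (g := fun=> up)).
- exact: uniq_parts_of.
- exact: uniq_parts_le.
- move=> de; rewrite mem_parts_of mem_parts_le => /eqP sz /andP[h1 h2].
  have e := upU _ h1 h2; rewrite e in sz *; rewrite dn_pair hdn; split=> //; lia.
move=> ep; rewrite mem_parts_of mem_parts_le => le /and3P[h1 h2 h3].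
have e := dnU _ h1 h2; rewrite e in h3 *; rewrite up_pair hup; split=> //; lia.
Qed.

(** * Pieri's rule and the product formula for SSOTs *)

Fixpoint schurp (R : comNzRingType) (x : nat -> R) (N : nat) (lam : intpart) : R :=
  if N is N'.+1 then
    \sum_(ka <- parts_le (psize lam) | hstrip lam ka)
       x N' ^+ (psize lam - psize ka) * schurp x N' ka
  else (lam == part0)%:R.

(** The complete homogeneous symmetric polynomial h_b. *)
Fixpoint homp (R : comNzRingType) (x : nat -> R) (N b : nat) : R :=
  if N is N'.+1 then \sum_(t < b.+1) x N' ^+ t * homp x N' (b - t)
  else (b == 0%N)%:R.

(** The last variable records the removal of [ta / ka] followed by the addition of [lam / ka]. The
    bound [psize ka + n] on [ta] loses nothing, because the removed strip has at most [n] boxes. *)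
Fixpoint ssp (R : comNzRingType) (x : nat -> R) (N : nat) (lam : intpart)
    (n : nat) : R :=
  if N is N'.+1 then
    \sum_(ka <- parts_le (psize lam) | hstrip lam ka)
      \sum_(ta <- parts_le (psize ka + n) | hstrip ta ka &&
          ((psize lam - psize ka) + (psize ta - psize ka) <= n)%N)
        x N' ^+ ((psize lam - psize ka) + (psize ta - psize ka)) *
        ssp x N' ta (n - ((psize lam - psize ka) + (psize ta - psize ka)))
  else ((lam == part0) && (n == 0%N))%:R.

(** Branching off the last variable gives [la] two lower neighbours, [de] and [ka]. [strip_commute]
    replaces [la] by a common lower neighbour [ta]: then [de / ta] is the branching of s_de,
    [ka / ta] is Pieri's rule in fewer variables, and the slack in the sizes is the exponent of the
    last variable in h_b. *)
Lemma pieri (R : comNzRingType) (x : nat -> R) N (de : intpart) b :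
  \sum_(la <- parts_of (psize de + b) | hstrip la de) schurp x N la =
  schurp x N de * homp x N b.
Proof.
elim: N de b => [|N IH] de b /=.
  case: (eqVneq de part0) => [->|de0]; last first.
    rewrite mul0r big_seq_cond big1 // => la /andP[_ h].
    case: eqP h => // -> /hstrip_psize; rewrite leqn0 => /eqP/psize_eq0 e.
    by rewrite e eqxx in de0.
  rewrite mul1r; have [->|b0] := eqVneq b 0%N.
    rewrite (@sum_point _ _ _ _ _ part0) ?eqxx ?uniq_parts_of // => la.
    rewrite mem_parts_of; apply/andP/eqP => [[/eqP/psize_eq0->]//|->].
    by rewrite hstrip_refl.
  rewrite big_seq_cond big1 // => la /andP[]; rewrite mem_parts_of => /eqP sz _.
  by case: eqP => // e; move: sz b0; rewrite e psize0 add0n => <-.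
pose D := (psize de + b)%N.
transitivity (\sum_(ka <- parts_le D)
    \sum_(ta <- parts_le (psize de) | [&& hstrip de ta, hstrip ka ta &
        (psize de + psize ka <= psize ta + D)%N])
      x N ^+ (D - psize ka) * schurp x N ka).
  under [RHS]eq_bigr => ka _ do rewrite -strip_commute.
  rewrite (exchange_big_dep (fun la => hstrip la de)) /=; last by move=> ? ? _ /andP[].
  rewrite [LHS]big_seq_cond [RHS]big_seq_cond.
  apply: eq_bigr => la /andP[]; rewrite mem_parts_of -/D => /eqP sz h.
  by rewrite sz; apply: eq_bigl => ka; rewrite h.
rewrite (exchange_big_dep (hstrip de)) /=; last by move=> ? ? _ /andP[].
rewrite big_distrl /=; apply: eq_bigr => ta h.
have le := hstrip_psize h.
rewrite -mulrA big_distrr /= big_distrr /=.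
transitivity (\sum_(t < b.+1)
   \sum_(ka <- parts_of (psize ta + (b - t)) | hstrip ka ta)
     x N ^+ (D - psize ka) * schurp x N ka).
  apply: (@partition_seq _ _ _ _ _ _ _ _ _ (fun ka => (psize ta + b - psize ka)%N)).
  - exact: uniq_parts_le.
  - by move=> t; apply: uniq_parts_of.
  - by move=> ka _ /and3P[_ /hstrip_psize]; lia.
  move=> t ka; rewrite mem_parts_of mem_parts_le h /=.
  have := ltn_ord t; case: (boolP (hstrip ka ta)) => [/hstrip_psize|_].
    by rewrite /D; lia.
  by rewrite !andbF.
apply: eq_bigr => t _; rewrite [schurp x N ta * _]mulrCA -IH !big_distrr /=.
rewrite [LHS]big_seq_cond [RHS]big_seq_cond.
apply: eq_bigr => ka /andP[]; rewrite mem_parts_of => /eqP sz _.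
by rewrite !mulrA -exprD; congr (_ ^+ _ * _); rewrite sz /D; have := ltn_ord t; lia.
Qed.

(** Both sides are s_de s_mu h_b, so a strip may pass from one factor to the other. *)
Lemma pieri_swap (R : comNzRingType) (x : nat -> R) N (de mu : intpart) b :
  (\sum_(la <- parts_of (psize de + b) | hstrip la de) schurp x N la) *
    schurp x N mu =
  schurp x N de *
    \sum_(la <- parts_of (psize mu + b) | hstrip la mu) schurp x N la.
Proof. by rewrite !pieri mulrAC mulrA. Qed.

(** This is the recursion of Littlewood's product: the new factors 1 / (1 - x_i x_N), i < N, expand
    into the sum of the x_N^a h_a, and h_a adds a strip of size a to [ep]. [paired_strip] trades the
    partition above [ka] for the one below. *)
Lemma sum_paired_schurpS (R : comNzRingType) (x : nat -> R) N D :
  \sum_(de <- parts_of D | paired de) schurp x N.+1 de =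
  \sum_(ep <- parts_le D | paired ep)
    \sum_(a < D.+1 | (psize ep + a.*2 == D)%N)
      x N ^+ a * \sum_(la <- parts_of (psize ep + a) | hstrip la ep) schurp x N la.
Proof.
transitivity (\sum_(ka <- parts_le D)
    \sum_(ep <- parts_le (psize ka) | [&& paired ep, hstrip ka ep &
        (psize ep + (D - psize ka) == psize ka)%N])
      x N ^+ (D - psize ka) * schurp x N ka).
  under eq_big_seq => ka.
    rewrite mem_parts_le => le; rewrite -paired_strip subnKC //; over.
  rewrite (exchange_big_dep paired) /=; last by move=> ? ? _ /andP[].
  rewrite [LHS]big_seq_cond [RHS]big_seq_cond.
  apply: eq_bigr => de /andP[]; rewrite mem_parts_of => /eqP sz pd.
  by rewrite sz; apply: eq_bigl => ka; rewrite pd.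
transitivity (\sum_(ka <- parts_le D)
    \sum_(ep <- parts_le D | [&& paired ep, hstrip ka ep &
        (psize ep + (D - psize ka) == psize ka)%N])
      x N ^+ (D - psize ka) * schurp x N ka).
  apply: eq_big_seq => ka; rewrite mem_parts_le => le.
  apply: eq_big_range; rewrite ?uniq_parts_le // => ep; rewrite !mem_parts_le.
  by case: (boolP (hstrip ka ep)) => [/hstrip_psize|_]; rewrite /= ?andbF; lia.
rewrite (exchange_big_dep paired) /=; last by move=> ? ? _ /andP[].
rewrite [LHS]big_seq_cond [RHS]big_seq_cond.
apply: eq_bigr => ep /andP[]; rewrite mem_parts_le => le pe.
transitivity (\sum_(a < D.+1 | (psize ep + a.*2 == D)%N)
   \sum_(ka <- parts_of (psize ep + a) | hstrip ka ep)
     x N ^+ (D - psize ka) * schurp x N ka).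
  apply: (@partition_seq _ _ _ _ _ _ _ _ _ (fun ka => (D - psize ka)%N)).
  - exact: uniq_parts_le.
  - by move=> a; apply: uniq_parts_of.
  - by move=> ka _ _; lia.
  move=> a ka; rewrite mem_parts_of mem_parts_le pe /=.
  case: (hstrip ka ep); rewrite ?andbF //=; have := ltn_ord a; lia.
apply: eq_bigr => a /eqP sz; rewrite big_distrr /=.
rewrite [LHS]big_seq_cond [RHS]big_seq_cond.
apply: eq_bigr => ka /andP[]; rewrite mem_parts_of => /eqP szk _.
by congr (_ ^+ _ * _); lia.
Qed.

(* Both sides obey the same recursion in the number of variables. The sum of the
   [s_de] is Littlewood's expansion of [\prod_(i < j) 1 / (1 - x_i x_j)]. *)
Lemma sspE (R : comNzRingType) (x : nat -> R) N (lam : intpart) n :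
  ssp x N lam n =
  \sum_(de <- parts_le n | paired de && (psize de + psize lam == n)%N)
    schurp x N de * schurp x N lam.
Proof.
elim: N lam n => [|N IH] lam n.
  rewrite /=; case: (eqVneq lam part0) => [->|l0] /=; last first.
    by rewrite big1 // => de _; rewrite mulr0.
  case: (eqVneq n 0%N) => [->|n0]; last first.
    rewrite big1 // => de /andP[_ /eqP e].
    have [e'|_] := eqVneq de part0; last by rewrite mul0r.
    by move: n0; rewrite -e e' psize0.
  rewrite (@sum_point _ _ _ _ _ part0) ?eqxx ?mulr1 ?uniq_parts_le // => de.
  rewrite mem_parts_le leqn0; apply/andP/eqP => [[/eqP/psize_eq0]//|->].
  by split=> //; apply/andP; split => //; apply/pairedP => i; rewrite !part_part0.
have [le|lt] := leqP (psize lam) n; last first.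
  rewrite /= big_seq_cond big1; last first.
    move=> ka /andP[_ /hstrip_psize le].
    rewrite big_seq_cond big1 // => ta /andP[_ /andP[/hstrip_psize le2 le3]].
    rewrite IH big_seq_cond big1 ?mulr0 // => de /andP[].
    by rewrite mem_parts_le => ? /andP[_ /eqP]; lia.
  by rewrite big_seq_cond big1 // => de /andP[_ /andP[_ /eqP]]; lia.
have [D nD] : exists D, n = (psize lam + D)%N by exists (n - psize lam)%N; lia.
transitivity ((\sum_(de <- parts_of D | paired de) schurp x N.+1 de) *
              schurp x N.+1 lam); last first.
  rewrite big_distrl; apply: eq_big_range.
  - exact: uniq_parts_of.
  - exact: uniq_parts_le.
  move=> de; rewrite mem_parts_of mem_parts_le.
  by case: (paired de); rewrite ?andbF //=; lia.
rewrite sum_paired_schurpS mulrC [ssp _ _ _ _]/= [schurp _ _ lam]/= big_distrl.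
apply: eq_bigr => ka h; have lek := hstrip_psize h.
(* The strip [ta / ka] counts twice in the degree: in the exponent of the last variable and in the
   size of [ta]. *)
transitivity (\sum_(ta <- parts_le (psize ka + n) | hstrip ta ka)
   \sum_(ep <- parts_le D |
       paired ep && (psize ep + (psize ta - psize ka).*2 == D)%N)
     x N ^+ (psize lam - psize ka + (psize ta - psize ka)) *
     (schurp x N ep * schurp x N ta)).
  rewrite big_mkcondr /=; apply: eq_bigr => ta /hstrip_psize let_.
  case: ifPn => [le1|le1].
    rewrite IH big_distrr /=; apply: eq_big_range; rewrite ?uniq_parts_le // => ep.
    by rewrite !mem_parts_le; case: (paired ep); rewrite ?andbF //=; lia.
  rewrite big_seq_cond big1 // => ep /andP[_ /andP[_ /eqP e]].
  by move: le1; rewrite -ltnNge; lia.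
rewrite (exchange_big_dep paired) /=; last by move=> ? ? _ /andP[].
rewrite mulrC big_distrl /=.
rewrite [LHS]big_seq_cond [RHS]big_seq_cond.
apply: eq_bigr => ep /andP[]; rewrite mem_parts_le => lee pe.
transitivity (\sum_(a < D.+1 | (psize ep + a.*2 == D)%N)
   \sum_(ta <- parts_of (psize ka + a) | hstrip ta ka)
     x N ^+ (psize lam - psize ka + (psize ta - psize ka)) *
     (schurp x N ep * schurp x N ta)).
  apply: (@partition_seq _ _ _ _ _ _ _ _ _ (fun ta => (psize ta - psize ka)%N)).
  - exact: uniq_parts_le.
  - by move=> a; apply: uniq_parts_of.
  - by move=> ta _ /andP[_ /andP[_ /eqP]]; lia.
  move=> a ta; rewrite mem_parts_of mem_parts_le pe /=.
  case: (boolP (hstrip ta ka)) => [/hstrip_psize|_]; rewrite ?andbF //=.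
  have := ltn_ord a; lia.
rewrite big_distrl /=; apply: eq_bigr => a _.
(* The strip of size [a] is added to [ka] by the SSOT, but to [ep] by the recursion for Littlewood's
   sum. *)
rewrite mulrACA pieri_swap -exprD.
rewrite !big_distrr /=; rewrite [LHS]big_seq_cond [RHS]big_seq_cond.
apply: eq_bigr => ta /andP[]; rewrite mem_parts_of => /eqP sz _.
congr (_ ^+ _ * _); lia.
Qed.

(** * Tableaux as chains of partitions *)

(* A tableau of shape [lam] with letters below [N] is encoded by the list of the
   shapes formed by the letters below [0, .., N-1]; taking [lam] as default value,
   [nth lam c k] is the shape of the letters below [k] for all [k]. *)
Fixpoint chains (N : nat) (lam : intpart) : seq (seq intpart) :=
  if N is N'.+1 then
    [seq rcons c ka | ka <- [seq ka <- parts_le (psize lam) | hstrip lam ka],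
                      c <- chains N' ka]
  else if lam == part0 then [:: [::]] else [::].

Definition wt (lam : intpart) (c : seq intpart) (k : nat) : nat :=
  psize (nth lam c k.+1) - psize (nth lam c k).

Lemma nth_rcons_default (T : Type) (a b : T) (c : seq T) k :
  (k <= size c)%N -> nth a (rcons c b) k = nth b c k.
Proof.
rewrite leq_eqVlt nth_rcons => /orP[/eqP->|lt]; last by rewrite lt (set_nth_default b).
by rewrite ltnn eqxx nth_default.
Qed.

Lemma chainsP N lam c :
  reflect [/\ size c = N, nth lam c 0 = part0 &
     forall k, (k < N)%N -> hstrip (nth lam c k.+1) (nth lam c k)]
   (c \in chains N lam).
Proof.
elim: N lam c => [|N IH] lam c /=.
  have [->|l0] := eqVneq lam part0.
    by rewrite inE; apply: (iffP eqP) => [->|[/size0nil->]].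
  by apply: ReflectF => -[/size0nil-> /= e]; rewrite e eqxx in l0.
apply: (iffP allpairsPdep) => [[ka [d [+ + ->]]]|[]].
  rewrite mem_filter => /andP[h _] /IH[sz d0 hd].
  split; first by rewrite size_rcons sz.
    by rewrite nth_rcons_default.
  move=> k; rewrite ltnS leq_eqVlt => /orP[/eqP->|lt].
    rewrite [nth _ _ N]nth_rcons_default -sz // nth_default ?size_rcons //.
    by rewrite nth_default.
  by have := hd k lt; rewrite !nth_rcons_default ?sz // ltnW.
case/lastP: c => // d ka; rewrite size_rcons => -[sz].
rewrite nth_rcons_default // => d0 hd.
have h : hstrip lam ka.
  have := hd N (ltnSn N); rewrite [nth _ _ N]nth_rcons_default -sz //.
  by rewrite nth_default ?size_rcons // nth_default.
exists ka, d; split => //; first by rewrite mem_filter h mem_parts_le hstrip_psize.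
apply/IH; split=> // k lt; have := hd k (ltnW lt).
by rewrite !nth_rcons_default ?sz // ltnW.
Qed.

Lemma uniq_chains N lam : uniq (chains N lam).
Proof.
elim: N lam => [|N IH] lam /=; first by case: ifP.
apply: allpairs_uniq_dep; first by rewrite filter_uniq ?uniq_parts_le.
  by move=> ka _; apply: IH.
by move=> p q _ _; case: p q => [ka c] [ka' c'] /= /rcons_inj[-> ->].
Qed.

Lemma schurp_chains (R : comNzRingType) (x : nat -> R) N lam :
  schurp x N lam = \sum_(c <- chains N lam) \prod_(k < N) x k ^+ wt lam c k.
Proof.
elim: N lam => [|N IH] lam /=.
  by case: eqP => _; rewrite ?big_nil // big_seq1 big_ord0.
rewrite big_allpairs_dep big_filter; apply: eq_bigr => ka _.
rewrite IH big_distrr /=; apply: eq_big_seq => c /chainsP[sz _ _].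
rewrite big_ord_recr /= mulrC; congr (_ * _).
  apply: eq_bigr => k _; rewrite /wt !nth_rcons_default ?sz // ltnW //.
by rewrite /wt [nth _ _ N]nth_rcons_default -sz // nth_default ?size_rcons // nth_default.
Qed.

Lemma chains_hstrip N lam c k :
  c \in chains N lam -> hstrip (nth lam c k.+1) (nth lam c k).
Proof.
move=> /chainsP[sz _ h]; have [|le] := ltnP k N; first exact: h.
by rewrite !nth_default ?sz ?hstrip_refl // ltnW.
Qed.

(** * Column statistics and the restricted Bender-Knuth involution *)

Lemma sum_part (f : nat -> nat) (nu : intpart) L : f 0%N = 0%N ->
  part nu L = 0%N ->
  (\sum_(i < psize nu) f (part nu i) = \sum_(i < L) f (part nu i))%N.
Proof.
move=> f0; have ext a b : (a <= b)%N -> part nu a = 0%N ->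
    (\sum_(i < a) f (part nu i) = \sum_(i < b) f (part nu i))%N.
  move=> ab nua; rewrite -!(big_mkord xpredT (fun i => f (part nu i))).
  rewrite (@big_cat_nat _ _ _ a 0 b) //= [X in (_ + X)%N]big1_seq ?addn0 //.
  move=> i /=; rewrite mem_index_iota => /andP[ai _].
  suff -> : part nu i = 0%N by [].
  by apply/eqP; rewrite -leqn0 -nua leq_part.
move=> nuL; have [le|/ltnW le] := leqP (psize nu) L.
  by apply: ext; rewrite ?part_psize.
by symmetry; apply: ext.
Qed.

(* Number of boxes of [nu] outside, resp. inside, the first [j] columns. *)
Definition out_size (j : nat) (nu : intpart) : nat :=
  (\sum_(i < psize nu) (part nu i - j))%N.
Definition in_size (j : nat) (nu : intpart) : nat :=
  (\sum_(i < psize nu) minn (part nu i) j)%N.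

Lemma in_out_size j nu : (in_size j nu + out_size j nu = psize nu)%N.
Proof.
rewrite [RHS](psizeE (part_psize (leqnn _))) /in_size /out_size -big_split /=.
by apply: eq_bigr => i _; lia.
Qed.

Lemma out_sizeE j nu L : part nu L = 0%N ->
  out_size j nu = (\sum_(i < L) (part nu i - j))%N.
Proof. by move=> e; rewrite /out_size (@sum_part (subn^~ j) _ L). Qed.

Lemma in_sizeE j nu L : part nu L = 0%N ->
  in_size j nu = (\sum_(i < L) minn (part nu i) j)%N.
Proof. by move=> e; rewrite /in_size (@sum_part (minn^~ j) _ L) ?min0n. Qed.

Lemma out_size0 nu : out_size 0 nu = psize nu.
Proof.
rewrite [RHS](psizeE (part_psize (leqnn _))) /out_size.
by apply: eq_bigr => i _; rewrite subn0.
Qed.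

Lemma out_size_eq0 j nu : (psize nu <= j)%N -> out_size j nu = 0%N.
Proof.
by move=> le; rewrite /out_size big1 // => i _; have := leq_part_psize nu i; lia.
Qed.

Lemma leq_out_size j nu mu : hstrip nu mu -> (out_size j mu <= out_size j nu)%N.
Proof.
move=> h; have le := hstrip_psize h.
rewrite (@out_sizeE j mu (psize nu)) ?part_psize //.
by apply: leq_sum => i _; have [a _] := hstripP _ _ h i; lia.
Qed.

(** The boxes of [nu / mu] beyond the first j and the first j+1 columns differ by those in column j,
    of which a horizontal strip has at most one. *)
Lemma out_size_step j nu mu : hstrip nu mu ->
  (out_size j nu + out_size j.+1 mu =
   out_size j.+1 nu + out_size j mu + `[< exists r, part mu r <= j < part nu r >])%N.
Proof.
move=> h; have le := hstrip_psize h.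
have zn : part nu (psize nu) = 0%N by apply: part_psize.
have zm : part mu (psize nu) = 0%N by apply: part_psize.
rewrite !(out_sizeE _ zn) !(out_sizeE _ zm).
have -> : (nat_of_bool `[< exists r, part mu r <= j < part nu r >] =
           \sum_(r < psize nu) (part mu r <= j < part nu r))%N.
  case: asboolP => [[r hr]|no]; last first.
    rewrite big1 // => r _.
    by case: (boolP (part mu r <= j < part nu r)%N) => // hr'; case: no; exists r.
  have rn : (r < psize nu)%N.
    rewrite ltnNge; apply/negP => ge; move: hr.
    by rewrite [part nu r]part_psize //; lia.
  rewrite (bigD1 (Ordinal rn)) //= hr big1 ?addn0 // => i ir.
  case: (boolP (part mu i <= j < part nu i)%N) => // hi.
  have /horizontal_stripE[_ box] := h.
  have ri : (i : nat) = r by apply: (box j).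
  by move: ir; rewrite -val_eqE /= ri eqxx.
rewrite -!big_split /=; apply: eq_bigr => r _.
have [a _] := hstripP _ _ h r; case: (boolP (part mu r <= j < part nu r)%N); lia.
Qed.

(* The Bender-Knuth involution on the middle term of [mu, ka, nu], restricted
   to the first [j] columns. *)
Definition bk_lo (j : nat) (mu nu : intpart) (r : nat) : nat :=
  minn j (maxn (part mu r) (part nu r.+1)).
Definition bk_hi (j : nat) (mu nu : intpart) (r : nat) : nat :=
  if r is r'.+1 then minn j (minn (part nu r) (part mu r')) else minn j (part nu 0).
Definition bk (j : nat) (mu ka nu : intpart) : intpart :=
  mkpart (fun r => (part ka r - j) +
     (bk_lo j mu nu r + bk_hi j mu nu r - minn (part ka r) j))%N (psize nu).

Section BenderKnuth.
Variables (j : nat) (mu ka nu : intpart).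
Hypothesis hmu : hstrip ka mu.
Hypothesis hnu : hstrip nu ka.
Hypothesis jcol : forall r, (j < part ka r)%N -> (j < part mu r)%N.

(** Interlacing confines each row of [ka], cut at column [j], to an interval, in which [bk] reflects
    it. By [jcol], column [j] has no box of [ka / mu]; hence in a row longer than [j] both bounds
    equal [j] and the row stays fixed, while a shorter row stays within the first [j] columns. *)
Lemma bk_bounds r :
  (bk_lo j mu nu r <= minn (part ka r) j <= bk_hi j mu nu r)%N.
Proof.
rewrite /bk_lo /bk_hi; have [a1 a2] := hstripP _ _ hmu r.
have [b1 b2] := hstripP _ _ hnu r; have c := @jcol r.
case: r a1 a2 b1 b2 c => [|r] a1 a2 b1 b2 c; first lia.
have [d1 d2] := hstripP _ _ hmu r; lia.
Qed.

Lemma bk_bounds2 r :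
  [/\ bk_lo j mu nu r <= minn (part ka r) j, minn (part ka r) j <= bk_hi j mu nu r,
      bk_hi j mu nu r <= j & ((j < part ka r) -> (j <= bk_lo j mu nu r))]%N.
Proof.
have /andP[-> ->] := bk_bounds r; have c := @jcol r.
by split => //; rewrite /bk_lo /bk_hi; [case: r c => [|r] c /=|]; lia.
Qed.

Let f r := (part ka r - j +
     (bk_lo j mu nu r + bk_hi j mu nu r - minn (part ka r) j))%N.

Let f_bounds r : [/\ part mu r <= f r, f r.+1 <= part mu r, f r <= part nu r &
                     part nu r.+1 <= f r]%N.
Proof.
have [a1 a2 a3 a4] := bk_bounds2 r; have [b1 b2 b3 b4] := bk_bounds2 r.+1.
have [c1 c2] := hstripP _ _ hmu r; have [d1 d2] := hstripP _ _ hnu r.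
have e1 : (minn j (maxn (part mu r) (part nu r.+1)) = bk_lo j mu nu r)%N by [].
have e2 : (bk_hi j mu nu r <= part nu r)%N by case: (r) => [|r'] /=; lia.
have e3 : (bk_hi j mu nu r.+1 <= part mu r)%N by rewrite /=; lia.
by rewrite /f; split; lia.
Qed.

Lemma part_bk r : part (bk j mu ka nu) r = f r.
Proof.
apply: part_mkpart => [i|].
  by have [a b _ _] := f_bounds i; apply: leq_trans b a.
have [_ _ + _] := f_bounds (psize nu).
by rewrite [part nu _]part_psize // leqn0 => /eqP.
Qed.

Lemma bk_hstrip_below : hstrip (bk j mu ka nu) mu.
Proof. by apply/hstripP => r; rewrite !part_bk; have [] := f_bounds r. Qed.

Lemma bk_hstrip_above : hstrip nu (bk j mu ka nu).
Proof. by apply/hstripP => r; rewrite !part_bk; have [] := f_bounds r. Qed.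

Lemma bk_col r : (j < part (bk j mu ka nu) r)%N -> (j < part mu r)%N.
Proof.
by rewrite part_bk /f => lt; apply: jcol; have [a b c d] := bk_bounds2 r; lia.
Qed.

Lemma bk_out_size i : (j <= i)%N -> out_size i (bk j mu ka nu) = out_size i ka.
Proof.
move=> ji; have z1 : part (bk j mu ka nu) (psize nu) = 0%N.
  by apply/part_psize/hstrip_psize/bk_hstrip_above.
have z2 : part ka (psize nu) = 0%N by apply/part_psize/hstrip_psize.
rewrite (out_sizeE _ z1) (out_sizeE _ z2); apply: eq_bigr => r _.
by rewrite part_bk /f; have [a b c d] := bk_bounds2 r; lia.
Qed.

(** In each row the reflection makes old and new lengths add up to [bk_lo] + [bk_hi]. Now [bk_lo] in
    row r and [bk_hi] in row r+1 are the maximum and the minimum of [part mu r] and [part nu r.+1],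
    both cut at [j], so pairing them diagonally gives the sizes of [mu] and [nu]. *)
Lemma bk_in_size :
  (in_size j (bk j mu ka nu) + in_size j ka = in_size j mu + in_size j nu)%N.
Proof.
have le1 := hstrip_psize hnu; have le2 := hstrip_psize hmu.
have z1 : part (bk j mu ka nu) (psize nu).+1 = 0%N.
  by apply/part_psize/leqW/hstrip_psize/bk_hstrip_above.
have z2 : part ka (psize nu).+1 = 0%N by apply/part_psize; lia.
have z3 : part mu (psize nu) = 0%N by apply/part_psize; lia.
have z4 : part nu (psize nu).+1 = 0%N by apply/part_psize; lia.
rewrite (in_sizeE _ z1) (in_sizeE _ z2) (in_sizeE _ z3) (in_sizeE _ z4).
transitivity (\sum_(r < (psize nu).+1) (bk_lo j mu nu r + bk_hi j mu nu r))%N.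
  rewrite -big_split /=; apply: eq_bigr => r _; rewrite part_bk /f.
  by have [a b c d] := bk_bounds2 r; lia.
have recl (F : nat -> nat) n :
    (\sum_(i < n.+1) F i = F 0 + \sum_(i < n) F i.+1)%N by rewrite big_ord_recl.
rewrite big_split /= big_ord_recr /= (recl (bk_hi j mu nu)).
rewrite (recl (fun r => minn (part nu r) j)).
have -> : bk_lo j mu nu (psize nu) = 0%N by rewrite /bk_lo z4 z3 minn0.
have : (\sum_(i < psize nu) bk_lo j mu nu i + \sum_(i < psize nu) bk_hi j mu nu i.+1 =
  \sum_(i < psize nu) minn (part mu i) j + \sum_(i < psize nu) minn (part nu i.+1) j)%N.
  by rewrite -!big_split /=; apply: eq_bigr => i _; rewrite /bk_lo; lia.
by rewrite /=; lia.
Qed.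

End BenderKnuth.

Lemma bkK j mu ka nu : hstrip ka mu -> hstrip nu ka ->
  (forall r, (j < part ka r)%N -> (j < part mu r)%N) ->
  bk j mu (bk j mu ka nu) nu = ka.
Proof.
move=> h1 h2 h3; have hb := bk_hstrip_below h1 h2 h3.
have ha := bk_hstrip_above h1 h2 h3; have hc := bk_col h1 h2 h3.
apply: part_ext => r; rewrite (part_bk hb ha hc) (part_bk h1 h2 h3).
by have [a b c d] := bk_bounds2 h1 h2 h3 r; lia.
Qed.

(** * Stembridge's involution *)

Definition wt_out (j : nat) (lam : intpart) (c : seq intpart) (k : nat) : nat :=
  out_size j (nth lam c k.+1) - out_size j (nth lam c k).

Lemma wt_out0 lam c k : wt_out 0 lam c k = wt lam c k.
Proof. by rewrite /wt_out !out_size0. Qed.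

Lemma nth_chain_psize N lam c k : c \in chains N lam ->
  (psize (nth lam c k) <= psize lam)%N.
Proof.
move=> cc; have le d : (psize (nth lam c k) <= psize (nth lam c (k + d)))%N.
  elim: d => [|d IH]; first by rewrite addn0.
  by rewrite addnS (leq_trans IH) // hstrip_psize // (chains_hstrip _ cc).
have := le N; rewrite [nth _ _ (k + N)]nth_default //.
by have [-> _ _] := chainsP _ _ _ cc; lia.
Qed.

Lemma wt_out_default N lam c j k : c \in chains N lam -> (psize lam <= j)%N ->
  wt_out j lam c k = 0%N.
Proof.
move=> cc le; rewrite /wt_out out_size_eq0 //.
exact: leq_trans (nth_chain_psize _ cc) le.
Qed.

Definition flip (lam : intpart) (j k : nat) (c : seq intpart) : seq intpart :=
  set_nth lam c k.+1 (bk j (nth lam c k) (nth lam c k.+1) (nth lam c k.+2)).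

Section Flip.
Variables (N : nat) (lam : intpart) (c : seq intpart) (j k : nat).
Hypothesis cc : c \in chains N lam.
Hypothesis kN : (k.+1 < N)%N.
Hypothesis jcol : forall r, (j < part (nth lam c k.+1) r)%N ->
  (j < part (nth lam c k) r)%N.

Let h1 := chains_hstrip k cc.
Let h2 := chains_hstrip k.+1 cc.

Lemma nth_flip i : nth lam (flip lam j k c) i =
  if i == k.+1 then bk j (nth lam c k) (nth lam c k.+1) (nth lam c k.+2)
  else nth lam c i.
Proof. by rewrite nth_set_nth. Qed.

Lemma flip_chains : flip lam j k c \in chains N lam.
Proof.
have [sz c0 hs] := chainsP _ _ _ cc.
apply/chainsP; split.
- by rewrite size_set_nth sz; apply/maxn_idPr.
- by rewrite nth_flip.
move=> i iN; rewrite !nth_flip eqSS; have [->|ik] := eqVneq i k.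
  by rewrite ltn_eqF // bk_hstrip_below.
have [->|_] := eqVneq i k.+1; last exact: hs.
exact: bk_hstrip_above.
Qed.

Lemma flipK : flip lam j k (flip lam j k c) = c.
Proof.
have [sz _ _] := chainsP _ _ _ cc; have [sz' _ _] := chainsP _ _ _ flip_chains.
apply: (@eq_from_nth _ lam) => [|i _].
  by rewrite size_set_nth sz' sz; apply/maxn_idPr.
rewrite [LHS]nth_set_nth /=; case: eqP => [->|ne].
  rewrite !nth_flip eqxx ltn_eqF // eqn_leq ltnn /= bkK //.
by rewrite nth_flip (introF eqP ne).
Qed.

Lemma out_size_flip a i : (j <= a)%N ->
  out_size a (nth lam (flip lam j k c) i) = out_size a (nth lam c i).
Proof. by move=> ja; rewrite nth_flip; case: eqP => // ->; rewrite bk_out_size. Qed.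

Lemma wt_out_flip a i : (j <= a)%N ->
  wt_out a lam (flip lam j k c) i = wt_out a lam c i.
Proof. by move=> ja; rewrite /wt_out !out_size_flip. Qed.

Lemma wt_flip_other i : i != k -> i != k.+1 ->
  wt lam (flip lam j k c) i = wt lam c i.
Proof.
by move=> ik ik1; rewrite /wt !nth_flip eqSS (negbTE ik) (negbTE ik1).
Qed.

Lemma flip_psize : (psize (nth lam (flip lam j k c) k.+1) +
    psize (nth lam c k.+1) + out_size j (nth lam c k) + out_size j (nth lam c k.+2) =
  psize (nth lam c k) + psize (nth lam c k.+2) + (out_size j (nth lam c k.+1)).*2)%N.
Proof.
rewrite nth_flip eqxx; have := bk_in_size h1 h2 jcol.
have := bk_out_size h1 h2 jcol (leqnn j).
have := in_out_size j (nth lam c k); have := in_out_size j (nth lam c k.+1).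
have := in_out_size j (nth lam c k.+2).
have := in_out_size j (bk j (nth lam c k) (nth lam c k.+1) (nth lam c k.+2)).
lia.
Qed.

(* Outside the first [j] columns nothing changes; inside, the numbers of letters
   [k] and [k.+1] are exchanged. *)
Lemma wt_flip :
  (wt lam (flip lam j k c) k + wt_out j lam c k.+1 =
   wt lam c k.+1 + wt_out j lam c k /\
   wt lam (flip lam j k c) k.+1 + wt_out j lam c k =
   wt lam c k + wt_out j lam c k.+1)%N.
Proof.
have e := flip_psize.
have l1 := leq_out_size j h1; have l2 := leq_out_size j h2.
have l3 := hstrip_psize h1; have l4 := hstrip_psize h2.
have l5 := hstrip_psize (chains_hstrip k flip_chains).
have l6 := hstrip_psize (chains_hstrip k.+1 flip_chains).
have n1 : nth lam (flip lam j k c) k = nth lam c k by rewrite nth_flip ltn_eqF.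
have n2 : nth lam (flip lam j k c) k.+2 = nth lam c k.+2.
  by rewrite nth_flip gtn_eqF.
rewrite n1 in l5; rewrite n2 in l6.
by rewrite /wt /wt_out n1 n2; split; lia.
Qed.

End Flip.

(** With [j = psize lam] all boxes lie in the first [j] columns, and the ordinary Bender-Knuth
    involution results. *)
Lemma flip_all N lam c k : c \in chains N lam -> (k.+1 < N)%N ->
  let c' := flip lam (psize lam) k c in
  [/\ c' \in chains N lam, flip lam (psize lam) k c' = c,
      wt lam c' k = wt lam c k.+1, wt lam c' k.+1 = wt lam c k &
      forall i, i != k -> i != k.+1 -> wt lam c' i = wt lam c i].
Proof.
move=> cc kN.
have jcol r : (psize lam < part (nth lam c k.+1) r)%N ->
    (psize lam < part (nth lam c k) r)%N.
  move=> lt; have := leq_part_psize (nth lam c k.+1) r.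
  by have := nth_chain_psize k.+1 cc; lia.
have [e1 e2] := wt_flip cc kN jcol; split.
- exact: flip_chains.
- exact: flipK cc kN jcol.
- by move: e1; rewrite !(wt_out_default _ cc) // !addn0.
- by move: e2; rewrite !(wt_out_default _ cc) // !addn0.
- exact: wt_flip_other.
Qed.

Lemma chains_sym (V : nmodType) N lam (w : {perm 'I_N})
    (F : ('I_N -> nat) -> V) :
  (forall a b, a =1 b -> F a = F b) ->
  \sum_(c <- chains N lam) F (fun i => wt lam c (w i)) =
  \sum_(c <- chains N lam) F (fun i => wt lam c i).
Proof.
move: w F; apply: perm_tperm_ind => [F Fe|s t IHs IHt F Fe|i j ij F Fe].
- by apply: eq_bigr => c _; apply: Fe => i; rewrite perm1.
- rewrite -(IHs _ Fe) -(IHt (fun a => F (fun i => a (s i)))) => [|a b e].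
    by apply: eq_bigr => c _; apply: Fe => i; rewrite permM.
  by apply: Fe => l; apply: e.
have iN : (i.+1 < N)%N by rewrite -ij.
apply: (big_bij (f := flip lam (psize lam) i) (g := flip lam (psize lam) i));
  rewrite ?uniq_chains // => c cc _; last by have [] := flip_all cc iN.
have [c1 c2 c3 c4 c5] := flip_all cc iN; split=> //; apply: Fe => l.
case: tpermP => [->|->|/eqP li /eqP lj]; rewrite ?ij ?c3 ?c4 //.
by rewrite c5 //; rewrite -?ij.
Qed.

(** * Alternants and the cancellation of bad tableaux *)

Definition alt (R : comNzRingType) (x : nat -> R) (N : nat) (ga : nat -> nat) : R :=
  \det (\matrix_(i < N, j < N) x i ^+ ga j).

Lemma eq_alt (R : comNzRingType) (x : nat -> R) N (ga de : nat -> nat) :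
  (forall i, (i < N)%N -> ga i = de i) -> alt x N ga = alt x N de.
Proof. by move=> e; congr (\det _); apply/matrixP => i j; rewrite !mxE e. Qed.

Lemma alt_swap (R : comNzRingType) (x : nat -> R) N (ga de : nat -> nat) k :
  (k.+1 < N)%N -> de k = ga k.+1 -> de k.+1 = ga k ->
  (forall i, i != k -> i != k.+1 -> de i = ga i) ->
  alt x N de = - alt x N ga.
Proof.
move=> kN e1 e2 e3; pose i := Ordinal (ltnW kN); pose j := Ordinal kN.
have ij : i != j by rewrite -val_eqE /= ltn_eqF.
have -> : alt x N de =
    \det (col_perm (tperm i j) (\matrix_(i < N, j < N) x i ^+ ga j)).
  congr (\det _); apply/matrixP => a b; rewrite !mxE.
  congr (_ ^+ _); case: tpermP => [->|->|/eqP bi /eqP bj] //.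
  by apply: e3.
rewrite col_permE det_mulmx tpermV det_perm odd_tperm ij expr1 mulrN1.
by [].
Qed.

(** By the symmetry of the weights, s_lam may be written in the term [w] of the determinant with
    exponents permuted by the same [w]. *)
Lemma schurp_alt (R : comNzRingType) (x : nat -> R) N lam (ga : nat -> nat) :
  schurp x N lam * alt x N ga =
  \sum_(c <- chains N lam) alt x N (fun i => ga i + wt lam c i)%N.
Proof.
rewrite /alt /determinant big_distrr /= [RHS]exchange_big /=.
apply: eq_bigr => w _; rewrite -big_distrr /= mulrCA; congr (_ * _).
rewrite schurp_chains -(@chains_sym _ _ _ w (fun a => \prod_(k < N) x k ^+ a k)).
  rewrite big_distrl /=; apply: eq_bigr => c _.
  by rewrite -big_split /=; apply: eq_bigr => i _; rewrite !mxE -exprD addnC.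
by move=> a b e; apply: eq_bigr => i _; rewrite e.
Qed.

Definition staircase (N i : nat) : nat := (N - i.+1)%N.

(** Stembridge's form of the Littlewood-Richardson lattice condition: whole columns are read from
    the right, starting from [de]. *)
Definition good (N : nat) (de : nat -> nat) (lam : intpart) (c : seq intpart) : bool :=
  `[< forall j k, (k.+1 < N)%N ->
      (de k.+1 + wt_out j lam c k.+1 <= de k + wt_out j lam c k)%N >].

Section Bad.
Variables (N : nat) (de : nat -> nat) (lam : intpart).
Hypothesis deS : forall k, (de k.+1 <= de k)%N.

Let bad c j k := (k.+1 < N)%N &&
  (de k + wt_out j lam c k < de k.+1 + wt_out j lam c k.+1)%N.

(** The largest bad [j], then the smallest [k]. Both depend only on the columns from [j] on, which
    the flip at [j] leaves unchanged; so the flipped chain has the same first bad pair, and flipping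
    is an involution. *)
Definition first_bad (c : seq intpart) (p : nat * nat) : Prop :=
  [/\ bad c p.1 p.2, forall i k, (p.1 < i)%N -> ~~ bad c i k &
      forall k, (k < p.2)%N -> ~~ bad c p.1 k].

Lemma first_bad_uniq c p q : first_bad c p -> first_bad c q -> p = q.
Proof.
case: p q => [j k] [j' k'] [/= b1 b2 b3] [/= b1' b2' b3'].
have e : j = j'.
  have [lt|lt|//] := ltngtP j j'.
    by have := b2 _ k' lt; rewrite b1'.
  by have := b2' _ k lt; rewrite b1.
move: b1' b2' b3'; rewrite -e => b1' b2' b3'.
have [lt|lt|-> //] := ltngtP k k'.
  by have := b3' _ lt; rewrite b1.
by have := b3 _ lt; rewrite b1'.
Qed.

Lemma first_bad_exists c : c \in chains N lam -> ~~ good N de lam c ->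
  exists p, first_bad c p.
Proof.
move=> cc; rewrite /good => /asboolPn ng.
pose P j := `[< exists k, bad c j k >].
have exP : exists j, P j.
  apply: contrapT => no; apply: ng => j k kN; rewrite leqNgt; apply/negP => lt.
  by apply: no; exists j; apply/asboolP; exists k; rewrite /bad kN.
(* Far to the right only [de] is left, and it is decreasing. *)
have ubP j : P j -> (j <= psize lam)%N.
  move=> /asboolP[k /andP[_ b]]; rewrite leqNgt; apply/negP => lt.
  by move: b; rewrite !(wt_out_default _ cc) ?(ltnW lt) //; have := deS k; lia.
case: (ex_maxnP exP ubP) => j /asboolP exk maxj.
case: (ex_minnP exk) => k bk mink; exists (j, k); split => //= [i k'|k'] lt.
  apply/negP => b; have := maxj i; rewrite leqNgt lt => /(_ _)/negP; apply => //.
  by apply/asboolP; exists k'.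
by apply/negP => /mink; rewrite leqNgt lt.
Qed.

Definition fix_bad (c : seq intpart) : seq intpart :=
  let p := xget (0%N, 0%N) [set p | first_bad c p] in flip lam p.1 p.2 c.

Lemma fix_badE c p : first_bad c p -> fix_bad c = flip lam p.1 p.2 c.
Proof.
move=> fp; rewrite /fix_bad; case: xgetP => [q -> fq|/(_ p)//].
by rewrite (first_bad_uniq fp fq).
Qed.

(* At the first bad place, the column [j] contains the letter [k.+1] but not the
   letter [k], and the inequality fails by exactly one. *)
Lemma first_bad_step c j k : c \in chains N lam -> first_bad c (j, k) ->
  (forall r, (j < part (nth lam c k.+1) r)%N -> (j < part (nth lam c k) r)%N) /\
  (de k.+1 + wt_out j lam c k.+1 = (de k + wt_out j lam c k).+1)%N.
Proof.
move=> cc [/= /andP[kN lt] later _].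
have := later j.+1 k (ltnSn j); rewrite /bad kN /= -leqNgt => le.
have h1 := chains_hstrip k cc; have h2 := chains_hstrip k.+1 cc.
have l1 := leq_out_size j h1; have l2 := leq_out_size j h2.
have l3 := leq_out_size j.+1 h1; have l4 := leq_out_size j.+1 h2.
have := out_size_step j h1; have := out_size_step j h2.
move: lt le; rewrite /wt_out.
case: (asboolP (exists r, _)) => [_|_]; case: (asboolP (exists r, _)) => [_|no] /=;
  move=> *; split; try lia.
move=> r jr; rewrite ltnNge; apply/negP => rj; apply: no.
by exists r; rewrite rj jr.
Qed.

Lemma fix_bad_spec c : c \in chains N lam -> ~~ good N de lam c ->
  [/\ fix_bad c \in chains N lam, ~~ good N de lam (fix_bad c),
      fix_bad (fix_bad c) = c &
      forall (R : comNzRingType) (x : nat -> R),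
        alt x N (fun i => de i + wt lam (fix_bad c) i + staircase N i)%N =
        - alt x N (fun i => de i + wt lam c i + staircase N i)%N].
Proof.
move=> cc ng; have [[j k] fb] := first_bad_exists cc ng.
have [jcol step] := first_bad_step cc fb.
have kN : (k.+1 < N)%N by have [/andP[]] := fb.
have wo i l : (j <= i)%N -> wt_out i lam (flip lam j k c) l = wt_out i lam c l.
  by move=> ji; rewrite (wt_out_flip cc).
have fb' : first_bad (flip lam j k c) (j, k).
  have [b1 b2 b3] := fb; split; rewrite /bad /=.
  - by rewrite !wo.
  - by move=> i l lt; rewrite !wo ?(ltnW lt) //; apply: b2.
  - by move=> l lt; rewrite !wo //; apply: b3.
rewrite (fix_badE fb) (fix_badE fb') /= (flipK cc kN jcol).
split => //; first exact: flip_chains.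
  apply/negP => /asboolP/(_ j k kN).
  by have [/= /andP[_ lt] _ _] := fb'; rewrite leqNgt lt.
(* The failure by exactly one is compensated by the unit step of the staircase: the flip exchanges
   the complete exponents at [k] and [k.+1]. *)
move=> R x; have [e1 e2] := wt_flip cc kN jcol.
apply: (@alt_swap R x N _ _ k kN); rewrite /staircase.
- by lia.
- by lia.
- by move=> i ik ik1; rewrite wt_flip_other.
Qed.

Lemma schurp_alt_good (R : comNzRingType) (x : nat -> R) :
  (forall y : R, y = - y -> y = 0) ->
  schurp x N lam * alt x N (fun i => de i + staircase N i)%N =
  \sum_(c <- chains N lam | good N de lam c)
     alt x N (fun i => de i + wt lam c i + staircase N i)%N.
Proof.
(* Fixed points of [fix_bad] are not excluded; the sum over the bad chains is shown to be its own
   opposite, and [char2] concludes. *)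
move=> char2; rewrite schurp_alt (bigID (good N de lam)) /= [X in _ + X]char2.
  by rewrite addr0; apply: eq_bigr => c _; apply: eq_alt => i _; lia.
rewrite -sumrN; apply: (big_bij (f := fix_bad) (g := fix_bad));
  rewrite ?uniq_chains // => c cc ng; have [c1 c2 c3 c4] := fix_bad_spec cc ng.
  split => //; rewrite -[RHS]opprK; congr (- _).
  have := c4 R x; under eq_alt do rewrite addnAC; move=> ->.
  by congr (- _); apply: eq_alt => i _; rewrite addnAC.
by split.
Qed.

End Bad.

(** * Products of Schur polynomials *)

Section Superstandard.
Variables (N : nat) (lam : intpart).
Hypothesis lamN : part lam N = 0%N.

Let top_rows (k : nat) : intpart :=
  mkpart (fun r => if (r < k)%N then part lam r else 0%N) k.

Let part_top_rows k r : part (top_rows k) r = if (r < k)%N then part lam r else 0%N.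
Proof.
rewrite part_mkpart ?ltnn // => i; case: ifP => [lt|//].
by rewrite (ltn_trans (ltnSn i) lt) partS.
Qed.

Let top_rowsN : top_rows N = lam.
Proof.
apply: part_ext => r; rewrite part_top_rows; case: ltnP => // le.
by apply/eqP; rewrite eq_sym -leqn0 -lamN leq_part.
Qed.

Definition superstandard : seq intpart := mkseq top_rows N.

Let nth_superstandard k : (k <= N)%N -> nth lam superstandard k = top_rows k.
Proof.
rewrite leq_eqVlt => /orP[/eqP->|lt]; last by rewrite nth_mkseq.
by rewrite nth_default ?size_mkseq ?top_rowsN.
Qed.

Let wt_out_superstandard j k : (k < N)%N ->
  wt_out j lam superstandard k = (part lam k - j)%N.
Proof.
move=> kN; rewrite /wt_out !nth_superstandard //; last exact: ltnW.
rewrite (@out_sizeE _ _ k.+1) ?part_top_rows ?ltnn //.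
rewrite (@out_sizeE _ _ k) ?part_top_rows ?ltnn //.
rewrite big_ord_recr /= part_top_rows ltnSn.
rewrite (eq_bigr (fun i : 'I_k => (part (top_rows k) i - j)%N)) ?addKn // => i _.
by rewrite !part_top_rows ltn_ord ltnW // ltnS.
Qed.

Lemma superstandard_chains : superstandard \in chains N lam.
Proof.
apply/chainsP; split; first by rewrite size_mkseq.
  rewrite nth_superstandard //; apply: part_ext => r.
  by rewrite part_top_rows part_part0.
move=> k kN; rewrite !nth_superstandard //; last exact: ltnW.
apply/hstripP => r; rewrite !part_top_rows ltnS; have := partS lam r.
by split; do 2! case: ifP; lia.
Qed.

Lemma superstandard_good : good N (fun=> 0%N) lam superstandard.
Proof.
apply/asboolP => j k kN; rewrite !add0n !wt_out_superstandard //; last exact: ltnW.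
by apply: leq_sub2r; apply: partS.
Qed.

Lemma wt_superstandard k : (k < N)%N -> wt lam superstandard k = part lam k.
Proof. by move=> kN; rewrite -wt_out0 wt_out_superstandard // subn0. Qed.

(* Row by row: once the rows above are filled, the letters [r] outside the first
   [lam_r - 1] columns can only lie in row [r]; there is at least one of them,
   because some letter [v >= r] ends row [r]. *)
Lemma good_superstandard c : c \in chains N lam -> good N (fun=> 0%N) lam c ->
  c = superstandard.
Proof.
move=> cc /asboolP gd; have [sz c0 _] := chainsP _ _ _ cc.
have cN : nth lam c N = lam by rewrite nth_default ?sz.
have low k : forall r, (k <= r)%N -> part (nth lam c k) r = 0%N.
  elim: k => [|k IH] r; first by rewrite c0 part_part0.
  case: r => // r kr; have [_] := hstripP _ _ (chains_hstrip k cc) r.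
  by rewrite IH // leqn0 => /eqP.
have mono r a b : (a <= b)%N -> (part (nth lam c a) r <= part (nth lam c b) r)%N.
  move=> /subnKC <-; elim: (b - a)%N => [|d IH]; first by rewrite addn0.
  rewrite addnS (leq_trans IH) //.
  by have [] := hstripP _ _ (chains_hstrip (a + d) cc) r.
have gd' j r v : (r <= v)%N -> (v < N)%N ->
    (wt_out j lam c v <= wt_out j lam c r)%N.
  move=> /subnKC <-; elim: (v - r)%N => [|d IH]; first by rewrite addn0.
  rewrite addnS => lt; apply: leq_trans (IH (ltnW lt)).
  by have := gd j (r + d)%N lt; rewrite !add0n.
have row r : (r < N)%N -> part (nth lam c r.+1) r = part lam r.
  elim/ltn_ind: r => r IH rN; apply/eqP; rewrite eqn_leq.
  have := mono r _ _ rN; rewrite cN => -> /=.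
  have [->//|p0] := posnP (part lam r).
  have exk : exists k, (part lam r <= part (nth lam c k) r)%N.
    by exists N; rewrite cN.
  case: (ex_minnP exk) => [[|v]] hv minv; first by move: hv; rewrite c0 part_part0; lia.
  have vN : (v < N)%N by apply: minv; rewrite cN.
  have lt : (part (nth lam c v) r < part lam r)%N.
    by rewrite ltnNge; apply/negP => /minv; rewrite ltnn.
  have rv : (r <= v)%N.
    by rewrite leqNgt; apply/negP => vr; move: hv; rewrite low //; lia.
  pose j := (part lam r).-1.
  have wv : (0 < wt_out j lam c v)%N.
    have h := chains_hstrip v cc; have := out_size_step j h.
    have -> : `[< exists r, part (nth lam c v) r <= j < part (nth lam c v.+1) r >]%N.
      by apply/asboolP; exists r; rewrite /j; lia.
    by have := leq_out_size j.+1 h; rewrite /wt_out /=; lia.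
  have := gd' j r v rv vN; rewrite {2}/wt_out.
  rewrite (out_sizeE _ (low r.+1 r.+1 (leqnn _))).
  rewrite (out_sizeE _ (low r r (leqnn _))).
  rewrite big_ord_recr /= (eq_bigr (fun i : 'I_r => (part (nth lam c r) i - j)%N)).
    by rewrite addKn; move: wv; rewrite /j; lia.
  move=> i _; congr (_ - _)%N.
  have iN : (i < N)%N by apply: ltn_trans rN.
  have e := IH i (ltn_ord i) iN.
  apply/eqP; rewrite eqn_leq (mono i r r.+1) // andbT.
  have := mono i _ _ rN; rewrite cN -e => /leq_trans -> //.
  exact: mono.
apply: (@eq_from_nth _ lam); first by rewrite size_mkseq sz.
move=> k; rewrite sz => kN; rewrite nth_superstandard ?(ltnW kN) //.
apply: part_ext => r; rewrite part_top_rows; case: ltnP => [rk|]; last exact: low.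
have rN : (r < N)%N by apply: ltn_trans kN.
apply/eqP; rewrite eqn_leq; have := mono r _ _ (ltnW kN); rewrite cN => -> /=.
by rewrite -row // mono.
Qed.

(** For [de = 0] a single chain survives the cancellation. *)
Lemma bialternant (R : comNzRingType) (x : nat -> R) :
  (forall y : R, y = - y -> y = 0) ->
  schurp x N lam * alt x N (staircase N) =
  alt x N (fun i => part lam i + staircase N i)%N.
Proof.
move=> char2; rewrite -[alt x N (staircase N)]/(alt x N (fun i => 0 + staircase N i)%N).
rewrite schurp_alt_good // (@sum_point _ _ _ _ _ superstandard) ?uniq_chains //.
  by apply: eq_alt => i iN; rewrite wt_superstandard.
move=> c; apply/andP/eqP => [[]|->]; first exact: good_superstandard.
by rewrite superstandard_chains superstandard_good.
Qed.

End Superstandard.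

Definition add_wt (N : nat) (de lam : intpart) (c : seq intpart) : intpart :=
  mkpart (fun i => if (i < N)%N then part de i + wt lam c i else 0)%N N.

Lemma part_add_wt N de lam c i : good N (part de) lam c ->
  part (add_wt N de lam c) i = if (i < N)%N then (part de i + wt lam c i)%N else 0%N.
Proof.
move=> /asboolP gd; rewrite part_mkpart ?ltnn // => k.
case: ifP => // kN; rewrite (ltn_trans (ltnSn k)) //.
by have := gd 0%N k kN; rewrite !wt_out0.
Qed.

Lemma sum_wt N lam c : c \in chains N lam ->
  (\sum_(k < N) wt lam c k = psize lam)%N.
Proof.
move=> cc; have [sz c0 _] := chainsP _ _ _ cc.
have tele M : (\sum_(k < M) wt lam c k = psize (nth lam c M))%N.
  elim: M => [|M IH]; first by rewrite big_ord0 c0.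
  by rewrite big_ord_recr /= IH /wt subnKC // hstrip_psize // (chains_hstrip _ cc).
by rewrite tele nth_default ?sz.
Qed.

Lemma psize_add_wt N de lam c : part de N = 0%N -> c \in chains N lam ->
  good N (part de) lam c -> psize (add_wt N de lam c) = (psize de + psize lam)%N.
Proof.
move=> dN cc gd; rewrite (@psizeE _ N) ?part_add_wt ?ltnn // (psizeE dN) -(sum_wt cc).
by rewrite -big_split; apply: eq_bigr => i _; rewrite part_add_wt // ltn_ord.
Qed.

(** * Coefficients of alternants, products and linear independence *)

Definition mvar (N k : nat) : {mpoly rat[N]} :=
  if insub k is Some i then 'X_i else 0.

Lemma prod_mvar N (e : nat -> nat) :
  \prod_(i < N) mvar N i ^+ e i = 'X_[ [multinom e i | i < N] ].
Proof.
rewrite mpolyXE_id; apply: eq_bigr => i _.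
by rewrite /mvar valK mnmE.
Qed.

Lemma mpoly_rat_opp N (p : {mpoly rat[N]}) : p = - p -> p = 0.
Proof.
move=> e; apply/mpolyP => m; have := congr1 (fun q => q@_m) e.
by rewrite mcoeffN mcoeff0 => /eqP; rewrite eq_sym eqNr => /eqP.
Qed.

(** An increasing permutation satisfies i <= w i, and its inverse is increasing too. *)
Lemma perm_increasing_id N (w : {perm 'I_N}) :
  (forall i j : 'I_N, (i < j)%N -> (w i < w j)%N) -> w = 1%g.
Proof.
have le (s : {perm 'I_N}) : (forall i j : 'I_N, (i < j)%N -> (s i < s j)%N) ->
    forall i : 'I_N, (i <= s i)%N.
  move=> inc [i]; elim: i => [|i IH] iN //=.
  have := IH (ltnW iN); have := inc (Ordinal (ltnW iN)) (Ordinal iN) (ltnSn i).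
  by move=> /=; lia.
move=> inc; have winv : forall i j : 'I_N, (i < j)%N -> (w^-1%g i < w^-1%g j)%N.
  move=> i j ij; rewrite ltnNge; apply/negP; rewrite leq_eqVlt => /orP[/eqP e|lt].
    have := congr1 w (val_inj e); rewrite !permKV => e'.
    by move: ij; rewrite e' ltnn.
  by have := inc _ _ lt; rewrite !permKV => /ltn_trans/(_ ij); rewrite ltnn.
apply/permP => i; rewrite perm1; apply: val_inj; apply/eqP.
rewrite eqn_leq le // andbT; have := le _ winv (w i).
by rewrite permK.
Qed.

(** Only the identity carries one strictly decreasing sequence of exponents to another, so an
    alternant has exactly one strictly decreasing monomial. *)
Lemma mcoeff_alt N (ga be : nat -> nat) :
  (forall i j, (i < j)%N -> (j < N)%N -> (ga j < ga i)%N) ->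
  (forall i j, (i < j)%N -> (j < N)%N -> (be j < be i)%N) ->
  (alt (mvar N) N ga)@_[multinom be i | i < N] =
    `[< forall i, (i < N)%N -> ga i = be i >]%:R.
Proof.
move=> dga dbe; rewrite /alt /determinant raddf_sum /=.
have e (w : {perm 'I_N}) : ((-1) ^+ w * \prod_(i < N)
    (\matrix_(i, j) mvar N i ^+ ga j) i (w i))@_[multinom be i | i < N] =
    (-1) ^+ w * `[< forall i, ga (w i) = be i >]%:R :> rat.
  rewrite -[(-1) ^+ w]/((-1) ^+ w : {mpoly rat[N]}).
  have -> : (-1) ^+ w = ((-1) ^+ w)%:MP_[N] :> {mpoly rat[N]}.
    by rewrite rmorphXn rmorphN rmorph1.
  rewrite mcoeffCM; congr (_ * _).
  have -> : \prod_(i < N) (\matrix_(i, j) mvar N i ^+ ga j) i (w i) =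
      'X_[ [multinom ga (w i) | i < N] ] :> {mpoly rat[N]}.
    rewrite mpolyXE_id; apply: eq_bigr => i _.
    by rewrite mxE /mvar valK mnmE.
  rewrite mcoeffX; congr (_%:R); congr nat_of_bool.
  apply/eqP/asboolP => [/mnmP h i|h]; last by apply/mnmP => i; rewrite !mnmE.
  by have := h i; rewrite !mnmE.
rewrite (eq_bigr _ (fun w _ => e w)) (bigD1 1%g) //= big1 => [|w w1].
  rewrite addr0 odd_perm1 mul1r; congr (_%:R); congr nat_of_bool.
  apply/asboolP/asboolP => h i; last by rewrite perm1 h.
  by move=> iN; have := h (Ordinal iN); rewrite perm1.
case: asboolP => h; last by rewrite mulr0.
case/eqP: w1; apply: perm_increasing_id => i j ij.
have [lt|lt|/val_inj/perm_inj eij] := ltngtP (w i) (w j) => //.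
  have := dga _ _ lt (ltn_ord _); have := dbe _ _ ij (ltn_ord _).
  by rewrite !h; lia.
by move: ij; rewrite eij ltnn.
Qed.

Lemma alt_staircase_neq0 N : alt (mvar N) N (staircase N) != 0.
Proof.
have dec i j : (i < j)%N -> (j < N)%N -> (staircase N j < staircase N i)%N.
  by rewrite /staircase; lia.
apply/eqP => /(congr1 (fun p => p@_[multinom staircase N i | i < N])).
by rewrite mcoeff_alt // mcoeff0 asboolT.
Qed.

(** After multiplication by a_rho, a nonzero element of an integral domain, the bialternant formula
    applies to s_de and to every summand on the right. *)
Lemma schurp_mul N (de lam : intpart) : part de N = 0%N ->
  schurp (mvar N) N de * schurp (mvar N) N lam =
  \sum_(c <- chains N lam | good N (part de) lam c)
     schurp (mvar N) N (add_wt N de lam c).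
Proof.
move=> dN; apply: (mulIf (alt_staircase_neq0 N)).
rewrite mulrAC bialternant //; last exact: mpoly_rat_opp.
rewrite mulrC schurp_alt_good; [|exact: partS|exact: mpoly_rat_opp].
rewrite big_distrl /=; apply: eq_bigr => c gd.
rewrite bialternant ?part_add_wt ?ltnn //; last exact: mpoly_rat_opp.
by apply: eq_alt => i iN; rewrite part_add_wt // iN.
Qed.

(** Multiply by a_rho and take the coefficient of x^(nu + rho). Since [n <= N], the first N rows
    determine a partition of n. *)
Lemma schurp_free N n (a : intpart -> rat) : (n <= N)%N ->
  \sum_(nu <- parts_of n) a nu *: schurp (mvar N) N nu = 0 ->
  forall nu, psize nu = n -> a nu = 0.
Proof.
move=> nN sum0 nu nun.
have dec (ka : intpart) i j : (i < j)%N -> (j < N)%N ->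
    (part ka j + staircase N j < part ka i + staircase N i)%N.
  by move=> ij jN; have := leq_part ka (ltnW ij); rewrite /staircase; lia.
have := congr1 (fun p => (p * alt (mvar N) N (staircase N))@_
  [multinom (part nu i + staircase N i)%N | i < N]) sum0.
rewrite mul0r mcoeff0 big_distrl raddf_sum /=.
rewrite (eq_big_seq (fun ka => if ka == nu then a ka else 0)) => [|ka].
  rewrite -big_mkcond (@sum_point _ _ _ _ _ nu) ?uniq_parts_of // => ka.
  by rewrite mem_parts_of; apply/andP/eqP => [[_ /eqP]//|->]; rewrite nun !eqxx.
rewrite mem_parts_of => /eqP kan.
rewrite -scalerAl bialternant ?part_psize ?kan //; last exact: mpoly_rat_opp.
rewrite mcoeffZ (mcoeff_alt (be := fun i => part nu i + staircase N i)%N);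
  [|exact: dec|exact: dec].
case: asboolP => [e|ne]; case: eqP => [kanu|kanu]; rewrite ?mulr1 ?mulr0 //.
  case: kanu; apply: part_ext => i; have [iN|Ni] := ltnP i N.
    by have := e i iN; lia.
  by rewrite !part_psize ?kan ?nun // (leq_trans nN).
by case: ne => i _; rewrite kanu.
Qed.

(** * Coefficients as numbers of tableaux and of SSOTs *)

Lemma card_fset_set_seq (T : choiceType) (A : set T) (s : seq T) :
  uniq s -> (forall x, A x <-> x \in s) -> #|` fset_set A| = size s.
Proof.
move=> us e; have fA : finite_set A.
  by apply: sub_finite_set (finite_seq s) => x /e.
apply: perm_size; apply: uniq_perm => // x.
by rewrite [LHS]in_fset_set //; apply/idP/idP; rewrite inE => /e.
Qed.

Definition has_wt (N : nat) (lam : intpart) (al : nat -> nat) (c : seq intpart) : bool :=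
  [forall i : 'I_N, wt lam c i == al i].

Lemma mcoeff_schurp N lam (al : nat -> nat) :
  (schurp (mvar N) N lam)@_[multinom al i | i < N] =
    (count (has_wt N lam al) (chains N lam))%:R.
Proof.
rewrite schurp_chains raddf_sum /= -sum1_count natr_sum.
rewrite [RHS]big_mkcond; apply: eq_bigr => c _; rewrite prod_mvar mcoeffX.
have -> : ([multinom wt lam c i | i < N] == [multinom al i | i < N]) = has_wt N lam al c.
  apply/eqP/forallP => [/mnmP h i|h]; first by have := h i; rewrite !mnmE => ->.
  by apply/mnmP => i; rewrite !mnmE; apply/eqP.
by case: (has_wt _ _ _ _).
Qed.

Lemma sorted_nth_lt (s : seq nat) j k : sorted leq s -> (j < size s)%N ->
  (nth 0%N s j < k)%N = (j < count (fun e => e < k)%N s)%N.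
Proof.
elim: s j => [|a s IH] j //= ps; have ss := path_sorted ps.
have ge e : e \in s -> (a <= e)%N.
  by move: ps; rewrite (path_sortedE leq_trans) => /andP[/allP h _] /h.
have c0 : (k <= a)%N -> count (fun e => e < k)%N s = 0%N.
  move=> ka; apply/eqP; rewrite -leqn0 leqNgt -has_count; apply/hasPn => e /ge.
  by rewrite -leqNgt; apply: leq_trans.
case: j => [|j] /=; first by case: (ltnP a k) => [|/c0->].
rewrite ltnS => js; rewrite IH //.
by case: (ltnP a k) => [_|/c0->]; rewrite ?add1n ?ltnS ?ltn0.
Qed.

Section Tableaux.
Variables (N : nat) (nu : intpart).

Definition ssyt_of_chain (c : seq intpart) : seq (seq nat) :=
  mkseq (fun r => mkseq (fun j =>
    find (fun k => j < part (nth nu c k.+1) r)%N (iota 0 N)) (part nu r)) (size nu).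

Definition sub_shape (T : seq (seq nat)) (k : nat) : intpart :=
  mkpart (fun r => count (fun e => e < k)%N (nth [::] T r)) (size nu).

Definition chain_of_ssyt (T : seq (seq nat)) : seq intpart :=
  mkseq (sub_shape T) N.

Section OfChain.
Variable c : seq intpart.
Hypothesis cc : c \in chains N nu.

Lemma chain_mono r a b : (a <= b)%N ->
  (part (nth nu c a) r <= part (nth nu c b) r)%N.
Proof.
move=> /subnKC <-; elim: (b - a)%N => [|d IH]; first by rewrite addn0.
rewrite addnS (leq_trans IH) //.
by have [] := hstripP _ _ (chains_hstrip (a + d) cc) r.
Qed.

Lemma chain_last : nth nu c N = nu.
Proof. by have [sz _ _] := chainsP _ _ _ cc; rewrite nth_default ?sz. Qed.

Let ent r j := find (fun k => j < part (nth nu c k.+1) r)%N (iota 0 N).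

Let ent_lt r j k : (k <= N)%N ->
  (ent r j < k)%N = (j < part (nth nu c k) r)%N.
Proof.
case: k => [|k] kN.
  by have [_ -> _] := chainsP _ _ _ cc; rewrite part_part0 !ltn0.
apply/idP/idP => [lt|lt].
  have hs : has (fun k => j < part (nth nu c k.+1) r)%N (iota 0 N).
    by rewrite has_find size_iota (leq_trans lt).
  have := nth_find 0%N hs; rewrite -/(ent r j) nth_iota ?add0n; last first.
    exact: leq_trans lt kN.
  by move=> /leq_trans; apply; apply: chain_mono.
rewrite ltnS leqNgt; apply/negP => /(before_find 0%N).
by rewrite nth_iota // add0n lt.
Qed.

Let ent_ltN r j : (j < part nu r)%N -> (ent r j < N)%N.
Proof. by move=> h; rewrite ent_lt // chain_last. Qed.

Let nth_ssyt r : (r < size nu)%N ->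
  nth [::] (ssyt_of_chain c) r = mkseq (ent r) (part nu r).
Proof. by move=> rn; rewrite nth_mkseq. Qed.

Let size_ssyt : size (ssyt_of_chain c) = size nu.
Proof. by rewrite size_mkseq. Qed.

Lemma ssyt_of_chain_ssyt : is_ssyt nu (ssyt_of_chain c).
Proof.
split.
- apply: (@eq_from_nth _ 0%N) => [|r]; rewrite size_map size_ssyt // => rn.
  by rewrite (nth_map [::]) ?size_ssyt // nth_ssyt // size_mkseq.
- apply/(all_nthP [::]) => r; rewrite size_ssyt => rn; rewrite nth_ssyt //.
  apply/(sortedP 0%N) => j; rewrite size_mkseq => jr.
  rewrite !nth_mkseq ?(ltnW jr) // -ltnS ent_lt; last exact: ent_ltN.
  by rewrite (ltn_trans (ltnSn j)) // -ent_lt ?ltnS //; apply: ent_ltN.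
move=> r j; rewrite size_ssyt => rn; rewrite !nth_ssyt ?(ltnW rn) // size_mkseq => jr.
have jr' : (j < part nu r)%N by apply: leq_trans jr (partS _ _).
rewrite !nth_mkseq // ent_lt; last exact/ltnW/ent_ltN.
have [_ h] := hstripP _ _ (chains_hstrip (ent r.+1 j) cc) r.
by apply: leq_trans h; rewrite -ent_lt //; apply: ent_ltN.
Qed.

Lemma count_ssyt_of_chain k r : (k <= N)%N ->
  count (fun e => e < k)%N (nth [::] (ssyt_of_chain c) r) = part (nth nu c k) r.
Proof.
move=> kN; have le : (part (nth nu c k) r <= part nu r)%N.
  by rewrite -[leqRHS](congr1 (part^~ r) chain_last) chain_mono.
have [nr|rn] := leqP (size nu) r.
  rewrite nth_default ?size_ssyt //=.
  by move: le; rewrite [part nu r]part_default // leqn0 => /eqP.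
rewrite nth_ssyt // count_map (eq_in_count (a2 := fun j => j < part (nth nu c k) r)%N).
  elim: (part nu r) le => [|n IH] le; first by move: le; rewrite leqn0 => /eqP->.
  rewrite -addn1 iotaD count_cat /= addn0 add0n; move: le; rewrite leq_eqVlt.
  case/orP => [/eqP e|lt]; last by rewrite IH // ltnNge -ltnS lt addn0.
  rewrite e leqnn addn1; congr _.+1; rewrite -[RHS](size_iota 0) -[RHS]count_predT.
  by apply: eq_in_count => j; rewrite mem_iota add0n => /andP[_ /leqW->].
by move=> j _; rewrite /= ent_lt.
Qed.

Lemma ssyt_of_chainK : chain_of_ssyt (ssyt_of_chain c) = c.
Proof.
have [sz _ _] := chainsP _ _ _ cc.
apply: (@eq_from_nth _ nu) => [|k]; first by rewrite size_mkseq sz.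
rewrite size_mkseq => kN; rewrite nth_mkseq //; apply: part_ext => r.
have e := fun r => count_ssyt_of_chain r (ltnW kN).
rewrite part_mkpart ?e // => [i|]; first by rewrite !e partS.
rewrite -e nth_default //; by rewrite size_ssyt.
Qed.

End OfChain.

Section OfTableau.
Variable T : seq (seq nat).
Hypothesis TT : is_ssyt nu T.

Let size_T : size T = size nu.
Proof. by have [h _ _] := TT; rewrite -(size_map size) h. Qed.

Let size_row r : size (nth [::] T r) = part nu r.
Proof.
have [h _ _] := TT; have [nr|rn] := leqP (size nu) r.
  by rewrite part_default // nth_default // size_T.
by rewrite /part -h (nth_map [::]) // size_T.
Qed.

Let row_sorted r : sorted leq (nth [::] T r).
Proof.
have [nr|rn] := leqP (size T) r; first by rewrite nth_default.
by have [_ /(all_nthP [::])/(_ r rn)] := TT.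
Qed.

Let cnt k r := count (fun e => e < k)%N (nth [::] T r).

Let cntS k r : (cnt k r <= cnt k.+1 r)%N.
Proof. by apply: sub_count => e /= /leqW. Qed.

Let cnt_col k r : (cnt k.+1 r.+1 <= cnt k r)%N.
Proof.
(* Otherwise column [cnt k r] has an entry at most [k] in row [r.+1], hence one below [k] in row
   [r]; but in row [r] the entries below [k] end just before this column. *)
rewrite leqNgt; apply/negP => lt.
have js : (cnt k r < part nu r.+1)%N.
  by rewrite -size_row (leq_trans lt) ?count_size.
have js' : (cnt k r < part nu r)%N by apply: leq_trans js (partS _ _).
have rT : (r.+1 < size T)%N.
  by rewrite ltnNge; apply/negP => le; move: js; rewrite -size_row nth_default.
have [_ _ /(_ r (cnt k r) rT)] := TT; rewrite size_row => /(_ js) col.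
move: lt; rewrite -[ltnRHS]/(count _ _) -sorted_nth_lt ?size_row // => lt.
have : (nth 0%N (nth [::] T r) (cnt k r) < k)%N by apply: leq_trans col _.
by rewrite sorted_nth_lt ?size_row // ltnn.
Qed.

Lemma part_sub_shape k r : part (sub_shape T k) r = cnt k r.
Proof.
apply: part_mkpart => [i|]; first exact: leq_trans (cntS _ _) (cnt_col _ _).
by rewrite nth_default ?size_T.
Qed.

Lemma psize_sub_shape k :
  psize (sub_shape T k) = count (fun e => e < k)%N (flatten T).
Proof.
rewrite (@psizeE _ (size T)) ?part_sub_shape; last by rewrite /cnt nth_default.
rewrite count_flatten sumnE big_map (big_nth [::]) big_mkord.
by apply: eq_bigr => i _; rewrite part_sub_shape.
Qed.

Hypothesis T_lt : forall i, (N <= i)%N -> count_mem i (flatten T) = 0%N.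

Lemma sub_shapeN : sub_shape T N = nu.
Proof.
apply: part_ext => r; rewrite part_sub_shape /cnt -size_row.
apply/eqP; rewrite -all_count; apply/allP => e er.
rewrite ltnNge; apply/negP => /T_lt/eqP; rewrite -leqn0 leqNgt -has_count has_pred1.
apply/negP/negPn/flattenP; exists (nth [::] T r) => //; apply: mem_nth.
by rewrite ltnNge; apply/negP => le; move: er; rewrite nth_default.
Qed.

Lemma nth_chain_of_ssyt k : (k <= N)%N -> nth nu (chain_of_ssyt T) k = sub_shape T k.
Proof.
rewrite leq_eqVlt => /orP[/eqP->|lt]; last by rewrite nth_mkseq.
by rewrite nth_default ?size_mkseq ?sub_shapeN.
Qed.

Lemma chain_of_ssyt_chains : chain_of_ssyt T \in chains N nu.
Proof.
apply/chainsP; split; first by rewrite size_mkseq.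
  rewrite nth_chain_of_ssyt //; apply: part_ext => r.
  rewrite part_sub_shape part_part0 /cnt (eq_count (a2 := pred0)) ?count_pred0 //.
move=> k kN; rewrite !nth_chain_of_ssyt ?(ltnW kN) //; apply/hstripP => r.
by rewrite !part_sub_shape.
Qed.

Lemma wt_chain_of_ssyt k : (k < N)%N ->
  wt nu (chain_of_ssyt T) k = count_mem k (flatten T).
Proof.
move=> kN; rewrite /wt !nth_chain_of_ssyt ?(ltnW kN) // !psize_sub_shape.
elim: (flatten T) => //= a s IH.
have : (count (fun e => e < k) s <= count (fun e => e < k.+1) s)%N.
  by apply: sub_count => e /= /leqW.
by move: IH; case: (ltngtP a k); rewrite ?ltnS; case: leqP; lia.
Qed.

Lemma chain_of_ssytK : ssyt_of_chain (chain_of_ssyt T) = T.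
Proof.
apply: (@eq_from_nth _ [::]) => [|r]; first by rewrite size_mkseq size_T.
rewrite size_mkseq => rn; rewrite nth_mkseq //.
apply: (@eq_from_nth _ 0%N) => [|j]; first by rewrite size_mkseq size_row.
rewrite size_mkseq => jr; rewrite nth_mkseq //.
set e := nth 0%N _ j.
have e_lt k : (e < k)%N = (j < cnt k r)%N by rewrite sorted_nth_lt ?size_row.
have eN : (e < N)%N by rewrite e_lt -part_sub_shape sub_shapeN.
have hs k : (k < N)%N ->
    (j < part (nth nu (chain_of_ssyt T) k.+1) r)%N = (e < k.+1)%N.
  by move=> kN; rewrite nth_chain_of_ssyt // part_sub_shape e_lt.
rewrite (@eq_in_find _ _ (fun k => e < k.+1)%N); last first.
  by move=> k; rewrite mem_iota => /andP[_ kN]; apply: hs.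
apply/eqP; rewrite eqn_leq; apply/andP; split; rewrite leqNgt; apply/negP => lt.
  by have := before_find 0%N lt; rewrite nth_iota // add0n ltnSn.
have hf : has (fun k => e < k.+1)%N (iota 0 N).
  by rewrite has_find size_iota (ltn_trans lt).
have := nth_find 0%N hf; rewrite nth_iota ?add0n; last exact: ltn_trans lt eN.
by rewrite ltnS leqNgt lt.
Qed.

End OfTableau.

(** A monomial in the first N variables only sees tableaux with letters below N, which are exactly
    the chains. *)
Lemma schurE (al : expvec) : (forall i, (N <= i)%N -> al i = 0%N) ->
  schur nu al = (schurp (mvar N) N nu)@_[multinom al i | i < N].
Proof.
move=> alN; rewrite mcoeff_schurp /schur; congr (_%:R).
pose s := [seq c <- chains N nu | has_wt N nu al c].
rewrite -size_filter -/s -(size_map ssyt_of_chain); apply: card_fset_set_seq.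
  rewrite map_inj_in_uniq ?filter_uniq ?uniq_chains // => c d.
  rewrite !mem_filter => /andP[_ cc] /andP[_ dc] e.
  by rewrite -(ssyt_of_chainK cc) e ssyt_of_chainK.
move=> T; split=> [[TT content]|].
  have T_lt i : (N <= i)%N -> count_mem i (flatten T) = 0%N.
    by move=> iN; rewrite content alN.
  apply/mapP; exists (chain_of_ssyt T); last by rewrite chain_of_ssytK.
  rewrite mem_filter chain_of_ssyt_chains // andbT; apply/forallP => i.
  by rewrite wt_chain_of_ssyt // content.
case/mapP => c; rewrite mem_filter => /andP[/forallP wc cc ->].
have TT := ssyt_of_chain_ssyt cc; split => // i.
have T_lt a : (N <= a)%N -> count_mem a (flatten (ssyt_of_chain c)) = 0%N.
  move=> aN; apply/eqP; rewrite -leqn0 leqNgt -has_count has_pred1.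
  apply/negP => /flattenP[row /(nthP [::])[r rn <-]] ar.
  have := count_ssyt_of_chain cc r (leqnn N); rewrite chain_last // => e.
  have : all (fun e => e < N)%N (nth [::] (ssyt_of_chain c) r).
    rewrite all_count e; have [h _ _] := TT.
    by rewrite /part -h (nth_map [::]).
  by move=> /allP/(_ _ ar); rewrite ltnNge aN.
have [iN|Ni] := ltnP i N; last by rewrite T_lt // alN.
rewrite -wt_chain_of_ssyt // ssyt_of_chainK //.
by apply/eqP; apply: (wc (Ordinal iN)).
Qed.

End Tableaux.

(* An SSOT ending at [lam] after [N] steps is encoded by the list of the pairs
   [(S^i, S'^(i+1))] for [i < N], with default value [(lam, lam)]. *)
Definition step_wt (lam : intpart) (p : intpart * intpart) : nat :=
  (psize lam - psize p.2) + (psize p.1 - psize p.2).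

Fixpoint ssots (N : nat) (lam : intpart) (n : nat) : seq (seq (intpart * intpart)) :=
  if N is N'.+1 then
    [seq rcons c p |
       p <- [seq (ta, ka) | ka <- [seq ka <- parts_le (psize lam) | hstrip lam ka],
               ta <- [seq ta <- parts_le (psize ka + n) | hstrip ta ka &&
                       (step_wt lam (ta, ka) <= n)%N]],
       c <- ssots N' p.1 (n - step_wt lam p)]
  else if (lam == part0) && (n == 0%N) then [:: [::]] else [::].

Definition ssot_wt (lam : intpart) (c : seq (intpart * intpart)) (k : nat) : nat :=
  step_wt (nth (lam, lam) c k.+1).1 (nth (lam, lam) c k).

Lemma nth_rcons_fst (la : intpart) (d : seq (intpart * intpart)) p k :
  (k <= size d)%N -> (nth (la, la) (rcons d p) k).1 = (nth (p.1, p.1) d k).1.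
Proof.
rewrite leq_eqVlt nth_rcons => /orP[/eqP->|lt].
  by rewrite ltnn eqxx nth_default.
by rewrite lt (set_nth_default (p.1, p.1)).
Qed.

Lemma nth_rcons_lt (la : intpart) (d : seq (intpart * intpart)) p k :
  (k < size d)%N -> nth (la, la) (rcons d p) k = nth (p.1, p.1) d k.
Proof. by move=> lt; rewrite nth_rcons lt (set_nth_default (p.1, p.1)). Qed.

Lemma nth_rcons_last (la : intpart) (d : seq (intpart * intpart)) p :
  nth (la, la) (rcons d p) (size d) = p.
Proof. by rewrite nth_rcons ltnn eqxx. Qed.

Lemma ssot_wt_rcons la d p k : (k < size d)%N ->
  ssot_wt la (rcons d p) k = ssot_wt p.1 d k.
Proof. by move=> lt; rewrite /ssot_wt nth_rcons_fst // nth_rcons_lt. Qed.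

Lemma ssot_wt_last la d p : ssot_wt la (rcons d p) (size d) = step_wt la p.
Proof. by rewrite /ssot_wt nth_rcons_last nth_default ?size_rcons. Qed.

Lemma ssotsP N lam n c :
  reflect [/\ size c = N, (nth (lam, lam) c 0).1 = part0,
     forall k, (k < N)%N -> hstrip (nth (lam, lam) c k).1 (nth (lam, lam) c k).2 /\
                            hstrip (nth (lam, lam) c k.+1).1 (nth (lam, lam) c k).2 &
     (\sum_(k < N) ssot_wt lam c k = n)%N]
   (c \in ssots N lam n).
Proof.
have nth1 := nth_rcons_fst; have nth2 := nth_rcons_lt; have nth3 := nth_rcons_last.
have nth4 la (d : seq (intpart * intpart)) p :
    nth (la, la) (rcons d p) (size d).+1 = (la, la).
  by rewrite nth_default ?size_rcons.
have wt_rcons la (d : seq (intpart * intpart)) p :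
    (\sum_(k < (size d).+1) ssot_wt la (rcons d p) k =
     \sum_(k < size d) ssot_wt p.1 d k + step_wt la p)%N.
  rewrite big_ord_recr /= ssot_wt_last; congr addn.
  by apply: eq_bigr => k _; rewrite ssot_wt_rcons.
elim: N lam n c => [|N IH] lam n c /=.
  case: (boolP (_ && _)) => [/andP[/eqP-> /eqP->]|ne].
    rewrite inE; apply: (iffP eqP) => [->|[/size0nil->]] //.
    by split; rewrite ?big_ord0.
  apply: ReflectF => -[/size0nil-> /= e _]; rewrite big_ord0 => e2.
  by rewrite e -e2 !eqxx in ne.
apply: (iffP allpairsPdep) => [[p [d [+ + ->]]]|[]].
  case/allpairsPdep => ka [ta [+ + ->]] /IH[sz d0 hd wd].
  rewrite !mem_filter => /andP[h1 _] /andP[/andP[h2 le] _].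
  split; first by rewrite size_rcons sz.
  - by rewrite nth1.
  - move=> k; rewrite ltnS leq_eqVlt => /orP[/eqP->|lt].
      by rewrite -sz nth3 nth4.
    by rewrite nth2 ?sz // nth1 ?sz //; apply: hd.
  by rewrite -sz wt_rcons sz wd subnK.
case/lastP: c => // d [ta ka]; rewrite size_rcons => -[sz].
rewrite nth1 // => d0 hd wd.
rewrite -sz wt_rcons sz in wd.
have [h2 h1] := hd N (ltnSn N); rewrite -sz nth3 in h2; rewrite -sz nth3 nth4 in h1.
exists (ta, ka), d; split => //.
  apply/allpairsPdep; exists ka, ta; split => //.
    by rewrite mem_filter h1 mem_parts_le hstrip_psize.
  have le : (step_wt lam (ta, ka) <= n)%N by rewrite -wd leq_addl.
  rewrite mem_filter h2 le mem_parts_le /=; move: le; rewrite /step_wt /=; lia.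
apply/IH; split=> // [k lt|]; last by rewrite -wd addnK.
by have := hd k (ltnW lt); rewrite nth2 ?sz // nth1 ?sz.
Qed.

Lemma uniq_ssots N lam n : uniq (ssots N lam n).
Proof.
elim: N lam n => [|N IH] lam n /=; first by case: ifP.
apply: allpairs_uniq_dep; last first.
- by move=> p q _ _; case: p q => [p c] [q d] /= /rcons_inj[-> ->].
- by move=> p _; apply: IH.
apply: allpairs_uniq_dep; first by rewrite filter_uniq ?uniq_parts_le.
  by move=> ka _; rewrite filter_uniq ?uniq_parts_le.
by move=> p q _ _; case: p q => [ka ta] [ka' ta'] /= [-> ->].
Qed.

Lemma ssp_ssots (R : comNzRingType) (x : nat -> R) N lam n :
  ssp x N lam n = \sum_(c <- ssots N lam n) \prod_(k < N) x k ^+ ssot_wt lam c k.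
Proof.
elim: N lam n => [|N IH] lam n /=.
  by case: (_ && _); rewrite ?big_nil // big_seq1 big_ord0.
rewrite big_allpairs_dep big_allpairs_dep big_filter; apply: eq_bigr => ka _.
rewrite big_filter; apply: eq_bigr => ta _.
rewrite IH big_distrr /=; apply: eq_big_seq => c /ssotsP[sz _ _ _].
rewrite big_ord_recr /= mulrC; congr (_ * _).
  by apply: eq_bigr => k _; rewrite ssot_wt_rcons ?sz.
by rewrite -sz ssot_wt_last.
Qed.

Definition has_ssot_wt (N : nat) (lam : intpart) (al : nat -> nat)
    (c : seq (intpart * intpart)) : bool :=
  [forall i : 'I_N, ssot_wt lam c i == al i].

Lemma mcoeff_ssp N lam n (al : nat -> nat) :
  (ssp (mvar N) N lam n)@_[multinom al i | i < N] =
    (count (has_ssot_wt N lam al) (ssots N lam n))%:R.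
Proof.
rewrite ssp_ssots raddf_sum /= -sum1_count natr_sum.
rewrite [RHS]big_mkcond; apply: eq_bigr => c _; rewrite prod_mvar mcoeffX.
have -> : ([multinom ssot_wt lam c i | i < N] == [multinom al i | i < N]) =
    has_ssot_wt N lam al c.
  apply/eqP/forallP => [/mnmP h i|h]; first by have := h i; rewrite !mnmE => ->.
  by apply/mnmP => i; rewrite !mnmE; apply/eqP.
by case: (has_ssot_wt _ _ _ _).
Qed.

Lemma ssot_length_sum (S : ssot_seq) N :
  (forall i, (N <= i)%N -> ssot_mult S i = 0%N) ->
  ssot_length S = (\sum_(i < N) ssot_mult S i)%N.
Proof.
move=> h; rewrite /ssot_length -(@fsbig_widen _ _ _ _ `I_N) //; last first.
  by move=> i /= [_ /negP]; rewrite -leqNgt => /h.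
by rewrite -fsbig_ord.
Qed.

Lemma hstrip_eq nu mu : hstrip nu mu -> (psize nu - psize mu = 0)%N -> nu = mu.
Proof.
move=> h e; apply/esym/leq_psize_eq => [i|]; first by have [] := hstripP _ _ h i.
by have := hstrip_psize h; lia.
Qed.

Definition ssot_of_seq (lam : intpart) (c : seq (intpart * intpart)) : ssot_seq :=
  (fun k => (nth (lam, lam) c k).1, fun k => (nth (lam, lam) c k).2).

Lemma ssE N lam n (al : expvec) : (forall i, (N <= i)%N -> al i = 0%N) ->
  ss lam n al = (ssp (mvar N) N lam n)@_[multinom al i | i < N].
Proof.
move=> alN; rewrite mcoeff_ssp /ss; congr (_%:R).
pose s := [seq c <- ssots N lam n | has_ssot_wt N lam al c].
have nthE c k : (nth (lam, lam) c k) =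
  ((ssot_of_seq lam c).1 k, (ssot_of_seq lam c).2 k) by exact: surjective_pairing.
have multE c k : ssot_mult (ssot_of_seq lam c) k = ssot_wt lam c k.
  by rewrite /ssot_mult /ssot_wt /step_wt /skew_size addnC.
rewrite -size_filter -/s -(size_map (ssot_of_seq lam)); apply: card_fset_set_seq.
  rewrite map_inj_in_uniq ?filter_uniq ?uniq_ssots // => c d.
  rewrite !mem_filter => /andP[_ /ssotsP[sc _ _ _]] /andP[_ /ssotsP[sd _ _ _]] e.
  apply: (@eq_from_nth _ (lam, lam)) => [|i _]; first by rewrite sc sd.
  by rewrite !nthE e.
move=> S; split=> [[[S0 hs1 hs2 [M SM]] len mult]|].
  have mult0 i : (N <= i)%N -> ssot_mult S i = 0%N by move=> iN; rewrite mult alN.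
  (* A zero exponent makes both strips empty, so the sequence is constant from N on; its eventual
     value identifies the constant as [lam]. *)
  have const i : (N <= i)%N -> S.1 i = S.2 i /\ S.1 i.+1 = S.2 i.
    move=> /mult0 e; have /horizontal_stripE h1 := hs1 i.
    have /horizontal_stripE h2 := hs2 i.
    move: e => /eqP; rewrite addn_eq0 => /andP[/eqP e1 /eqP e2].
    by split; apply: hstrip_eq.
  have constN d : S.1 (N + d)%N = S.1 N.
    elim: d => [|d <-]; first by rewrite addn0.
    by rewrite addnS; have [-> ->] := const (N + d)%N (leq_addr _ _).
  have S1 : S.1 N = lam.
    by rewrite -(constN M); have [] := SM (N + M)%N (leq_addl _ _).
  have Slam i : (N <= i)%N -> S.1 i = lam /\ S.2 i = lam.
    move=> Ni; have [<- _] := const i Ni.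
    by rewrite -(subnKC Ni) constN S1.
  pose c := mkseq (fun k => (S.1 k, S.2 k)) N.
  have cS k : nth (lam, lam) c k = (S.1 k, S.2 k).
    have [kN|Nk] := ltnP k N; first by rewrite nth_mkseq.
    by rewrite nth_default ?size_mkseq //; have [-> ->] := Slam k Nk.
  have eS : S = ssot_of_seq lam c.
    rewrite /ssot_of_seq [LHS]surjective_pairing.
    by congr pair; apply/funext => k; rewrite cS.
  apply/mapP; exists c => //; rewrite mem_filter; apply/andP; split.
    by apply/forallP => i; rewrite -multE -eS mult.
  apply/ssotsP; split; first by rewrite size_mkseq.
  - by rewrite cS.
  - by move=> k _; rewrite !cS; split; apply/horizontal_stripE; [apply: hs1 | apply: hs2].
  rewrite -len (ssot_length_sum mult0); apply: eq_bigr => k _.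
  by rewrite -multE -eS.
case/mapP => c; rewrite mem_filter => /andP[/forallP wc /ssotsP[sz c0 hc len]] ->.
have out k : (N <= k)%N -> nth (lam, lam) c k = (lam, lam).
  by move=> Nk; rewrite nth_default ?sz.
have mult0 i : (N <= i)%N -> ssot_mult (ssot_of_seq lam c) i = 0%N.
  by move=> Ni; rewrite multE /ssot_wt /step_wt !out ?leqW //= !subnn.
split.
- split => //.
  + move=> k; apply/horizontal_stripE => /=; have [kN|Nk] := ltnP k N.
      by have [] := hc k kN.
    by rewrite out //= hstrip_refl.
  + move=> k; apply/horizontal_stripE => /=; have [kN|Nk] := ltnP k N.
      by have [] := hc k kN.
    by rewrite !out ?leqW //= hstrip_refl.
  by exists N => i Ni /=; rewrite out.
- by rewrite (ssot_length_sum mult0) -[RHS]len; apply: eq_bigr => k _.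
move=> i; have [iN|Ni] := ltnP i N; last by rewrite mult0 ?alN.
by rewrite multE; apply/eqP; apply: (wc (Ordinal iN)).
Qed.

(** * The inner product *)

(* Coefficient of [s_nu] in [ss lam n], computed with [N] variables; it does not
   depend on [N >= n]. *)
Definition ss_coef (N : nat) (lam : intpart) (n : nat) (nu : intpart) : nat :=
  (\sum_(de <- parts_le n | paired de && (psize de + psize lam == n))
     count (fun c => good N (part de) lam c && (add_wt N de lam c == nu))
           (chains N lam))%N.

Lemma ss_coef_gt0P N lam n nu :
  reflect (exists de c, [/\ paired de, psize de + psize lam = n,
             c \in chains N lam, good N (part de) lam c & add_wt N de lam c = nu]%N)
          (0 < ss_coef N lam n nu)%N.
Proof.
rewrite /ss_coef lt0n sum_nat_seq_neq0.
apply: (iffP hasP) => [[de _]|[de [c [pd sz cc gd e]]]].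
  case/andP => /andP[pd /eqP sz]; rewrite -lt0n -has_count => /hasP[c cc /andP[gd /eqP e]].
  by exists de, c.
exists de; first by rewrite mem_parts_le -sz leq_addr.
rewrite pd sz eqxx -lt0n -has_count; apply/hasP; exists c => //.
by rewrite gd e eqxx.
Qed.

Lemma ssp_expansion N lam n : (n <= N)%N ->
  ssp (mvar N) N lam n =
  \sum_(nu <- parts_of n) (ss_coef N lam n nu)%:R *: schurp (mvar N) N nu.
Proof.
move=> nN; under eq_bigr do rewrite /ss_coef natr_sum scaler_suml.
rewrite sspE [RHS]exchange_big /= [LHS]big_seq_cond [RHS]big_seq_cond.
apply: eq_bigr => de /andP[]; rewrite mem_parts_le => den /andP[_ /eqP sz].
have dN : part de N = 0%N by apply/part_psize/(leq_trans den).
rewrite schurp_mul //; under [RHS]eq_bigr do rewrite -sum1_count natr_sum scaler_suml.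
rewrite (exchange_big_dep (good N (part de) lam)) /=; last by move=> ? ? _ /andP[].
rewrite [LHS]big_seq_cond [RHS]big_seq_cond; apply: eq_bigr => c /andP[cc gd].
under eq_bigr do rewrite scale1r.
rewrite (@sum_point _ _ _ _ _ (add_wt N de lam c)) ?uniq_parts_of // => nu.
rewrite gd mem_parts_of /=; apply/andP/eqP => [[_ /eqP]//|->].
by rewrite psize_add_wt // sz !eqxx.
Qed.

Lemma ss_expansion N lam n (al : expvec) : (n <= N)%N ->
  (forall i, (N <= i)%N -> al i = 0%N) ->
  ss lam n al = \sum_(nu <- parts_of n) (ss_coef N lam n nu)%:R * schur nu al.
Proof.
move=> nN alN; rewrite (ssE _ _ alN) ssp_expansion // raddf_sum /=.
by apply: eq_bigr => nu _; rewrite mcoeffZ (schurE _ alN).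
Qed.

Lemma schur_free N n (a : intpart -> rat) : (n <= N)%N ->
  (forall al : expvec, (forall i, (N <= i)%N -> al i = 0%N) ->
     \sum_(nu <- parts_of n) a nu * schur nu al = 0) ->
  forall nu, psize nu = n -> a nu = 0.
Proof.
move=> nN h; apply: (schurp_free nN); apply/mpolyP => m.
pose al : expvec := [fsfun i in seq_fset tt (iota 0 N) => nth 0%N m i].
have alE i : al i = if (i < N)%N then nth 0%N m i else 0%N.
  by rewrite fsfunE seq_fsetE mem_iota.
have alN i : (N <= i)%N -> al i = 0%N by rewrite alE ltnNge => ->.
have -> : m = [multinom al i | i < N].
  by apply/mnmP => i; rewrite mnmE alE ltn_ord (mnm_nth 0%N).
rewrite mcoeff0 -[RHS](h al alN) raddf_sum /=; apply: eq_bigr => nu _.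
by rewrite mcoeffZ (schurE _ alN).
Qed.

(** Both families expand the same series on monomials in n variables, where the Schur functions of
    degree n are already independent. *)
Lemma ss_coef_stable N lam n nu : (n <= N)%N -> psize nu = n ->
  ss_coef N lam n nu = ss_coef n lam n nu.
Proof.
move=> nN nun; apply/eqP; rewrite -(eqr_nat rat) -subr_eq0; apply/eqP.
apply: (@schur_free n n (fun nu => (ss_coef N lam n nu)%:R - (ss_coef n lam n nu)%:R))
  => // al aln.
under eq_bigr do rewrite mulrBl.
rewrite sumrB -!ss_expansion ?subrr // => i Ni.
by apply: aln; apply: leq_trans Ni.
Qed.

Lemma expvec_bounded (al : expvec) : exists N, forall i, (N <= i)%N -> al i = 0%N.
Proof.
exists (\max_(i <- finsupp al) i).+1 => i Ni; apply/eqP; rewrite -memNfinsupp.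
apply/negP => iS; have := @leq_bigmax_seq _ _ xpredT id i iS isT.
by rewrite leqNgt Ni.
Qed.

Lemma sum_psize (n : nat) (F : intpart -> rat) :
  \sum_(nu \in [set nu : intpart | psize nu = n]) F nu = \sum_(nu <- parts_of n) F nu.
Proof. by rewrite fsbig_finite //; apply: finite_psize. Qed.

(** [xget] may return any expansion; [schur_free] determines its values on the partitions of n. *)
Lemma schur_coef_ss N lam n nu : (n <= N)%N -> psize nu = n ->
  schur_coef n (ss lam n) nu = (ss_coef N lam n nu)%:R.
Proof.
move=> nN nun; rewrite ss_coef_stable //.
have ex : is_schur_expansion n (ss lam n) (fun nu => (ss_coef n lam n nu)%:R).
  move=> al; have [M alM] := expvec_bounded al.
  (* The monomial may involve more than n variables; n + M are enough for it, and stability brings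
     the coefficients back to n variables. *)
  rewrite sum_psize (@ss_expansion (n + M)) ?leq_addr // => [|i le]; last first.
    by apply: alM; apply: leq_trans le; apply: leq_addl.
  apply: eq_big_seq => ka; rewrite mem_parts_of => /eqP kan.
  by rewrite ss_coef_stable ?leq_addr.
rewrite /schur_coef; case: xgetP => [c _ hc|/(_ _ ex)//].
apply/eqP; rewrite -subr_eq0; apply/eqP.
apply: (@schur_free n n (fun nu => c nu - (ss_coef n lam n nu)%:R)) => // al _.
under eq_bigr do rewrite mulrBl.
by rewrite sumrB -!sum_psize -hc -ex subrr.
Qed.

Lemma hall_ss N lam mu n : (n <= N)%N ->
  hall n (ss lam n) (ss mu n) =
  (\sum_(nu <- parts_of n) ss_coef N lam n nu * ss_coef N mu n nu)%:R.
Proof.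
move=> nN; rewrite /hall sum_psize natr_sum; apply: eq_big_seq => nu.
by rewrite mem_parts_of => /eqP nun; rewrite !(schur_coef_ss _ nN) // natrM.
Qed.

Lemma hall_ss_gt0P N lam mu n : (n <= N)%N ->
  reflect (exists nu, [/\ psize nu = n, 0 < ss_coef N lam n nu &
                          0 < ss_coef N mu n nu]%N)
          (0 < hall n (ss lam n) (ss mu n)).
Proof.
move=> nN; rewrite (hall_ss _ _ nN) ltr0n lt0n sum_nat_seq_neq0.
apply: (iffP hasP) => [[nu]|[nu [sz c1 c2]]].
  by rewrite mem_parts_of -lt0n muln_gt0 => /eqP sz /= /andP[c1 c2]; exists nu.
exists nu; first by rewrite mem_parts_of sz.
by rewrite /= -lt0n muln_gt0 c1.
Qed.

(** * Positivity and its persistence *)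

Definition add11 (nu : intpart) : intpart :=
  mkpart (fun i => part nu i + (i < 2))%N (psize nu).+2.

Lemma part_add11 nu i : part (add11 nu) i = (part nu i + (i < 2))%N.
Proof.
apply: part_mkpart => [k|]; last by rewrite part_psize //; lia.
by have := partS nu k; lia.
Qed.

Lemma psize_add11 nu : psize (add11 nu) = (psize nu).+2.
Proof.
have z : part nu (psize nu).+2 = 0%N by apply/part_psize/leqW/leqW.
rewrite (@psizeE _ (psize nu).+2) ?part_add11 ?z //.
rewrite (eq_bigr (fun i : 'I__ => part nu i + (i < 2))%N) => [|i _]; last first.
  exact: part_add11.
by rewrite big_split /= -(psizeE z) !big_ord_recl big1 ?addn0 ?addn2.
Qed.

(** The same chain serves: the comparison of rows 0 and 1 is unchanged, that of rows 1 and 2 is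
    relaxed, and rows 0 and 1 form one pair of [de]. *)
Lemma ss_coef_add11 N lam n nu : (1 < N)%N -> (0 < ss_coef N lam n nu)%N ->
  (0 < ss_coef N lam n.+2 (add11 nu))%N.
Proof.
move=> N2 /ss_coef_gt0P[de [c [/pairedP pd sz cc gd e]]].
have gd' : good N (part (add11 de)) lam c.
  apply/asboolP => j k kN; have /asboolP/(_ j k kN) := gd.
  by rewrite !part_add11; case: k kN => [|[|k]] kN /=; lia.
apply/ss_coef_gt0P; exists (add11 de), c; split => //.
- by apply/pairedP => i; rewrite !part_add11 pd; case: i.
- by rewrite psize_add11 -sz.
apply: part_ext => i; rewrite part_add_wt // !part_add11 -e part_add_wt //.
by case: ltnP => Ni; [rewrite addnAC | rewrite add0n ltnNge (leq_trans N2)].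
Qed.

(** A standard tableau, built backwards by removing the last box of the last nonempty row. *)
Lemma single_box_chain (lam : intpart) : exists f : nat -> intpart,
  [/\ f (psize lam) = lam, forall i, (i <= psize lam)%N -> psize (f i) = i &
      forall i, (i < psize lam)%N -> hstrip (f i.+1) (f i)].
Proof.
move e : (psize lam) => m; elim: m lam e => [|m IH] lam e.
  by exists (fun=> lam); split=> // i; rewrite leqn0 => /eqP->.
have exr : exists k, part lam k == 0%N by exists (psize lam); rewrite part_psize.
case: (ex_minnP exr) => [[|r]] /eqP r0 minr.
  have : lam = part0.
    by apply: part_ext => i; apply/eqP; rewrite part_part0 -leqn0 -r0 leq_part.
  by move=> l0; rewrite l0 in e.
have rpos : (0 < part lam r)%N.
  by rewrite lt0n; apply/negP => /minr; rewrite ltnn.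
pose la := mkpart (fun i => part lam i - (i == r))%N (psize lam).+1.
have laE i : part la i = (part lam i - (i == r))%N.
  apply: part_mkpart => [k|]; last by rewrite part_psize.
  have := partS lam k; case: (eqVneq k r) => [->|_]; last by case: (k.+1 == r); lia.
  by rewrite r0.
have h : hstrip lam la.
  apply/hstripP => i; rewrite laE; split; first exact: leq_subr.
  have := partS lam i; case: (eqVneq i r) => [->|_]; last lia.
  by rewrite r0.
have lasz : psize la = m.
  have rL : (r < psize lam)%N.
    by rewrite ltnNge; apply/negP => le; move: rpos; rewrite part_psize.
  have z1 : part lam (psize lam) = 0%N by apply: part_psize.
  have z2 : part la (psize lam) = 0%N by rewrite laE z1.
  have s1 := psizeE z1; have s2 := psizeE z2.
  rewrite (bigD1 (Ordinal rL)) //= in s1; rewrite (bigD1 (Ordinal rL)) //= in s2.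
  have s3 : (\sum_(i < psize lam | i != Ordinal rL) part la i =
             \sum_(i < psize lam | i != Ordinal rL) part lam i)%N.
    apply: eq_bigr => i ir.
    by move: ir; rewrite -val_eqE laE /= => /negbTE->; rewrite subn0.
  move: s1 s2; rewrite s3 laE eqxx => s1 ->; apply/succn_inj.
  by rewrite -[RHS]e [RHS]s1 subn1 -addSn prednK.
have [f [f1 f2 f3]] := IH la lasz.
exists (fun i => if (i <= m)%N then f i else lam); split.
- by rewrite ltnn.
- move=> i im; have [->|ne] := eqVneq i m.+1; first by rewrite ltnn.
  have {}im : (i <= m)%N by lia.
  by rewrite im f2.
move=> i; rewrite ltnS => im; have [->|ne] := eqVneq i m.
  by rewrite ltnn leqnn f1.
have lt : (i < m)%N by lia.
by rewrite lt im f3.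
Qed.

Definition double_stair (m : nat) : intpart := mkpart (fun i => m - i./2)%N m.*2.

Lemma part_double_stair m i : part (double_stair m) i = (m - i./2)%N.
Proof. by apply: part_mkpart => [k|]; rewrite ?doubleK ?subnn //; lia. Qed.

Lemma leq_wt_out j N lam c k : c \in chains N lam -> (wt_out j lam c k <= wt lam c k)%N.
Proof.
move=> cc; have h := chains_hstrip k cc; rewrite /wt_out /wt.
have := in_out_size j (nth lam c k); have := in_out_size j (nth lam c k.+1).
suff : (in_size j (nth lam c k) <= in_size j (nth lam c k.+1))%N.
  by have := leq_out_size j h; lia.
have le := hstrip_psize h.
rewrite (@in_sizeE j (nth lam c k) (psize (nth lam c k.+1))) ?part_psize //.
by apply: leq_sum => r _; have [a _] := hstripP _ _ h r; lia.
Qed.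

(* The letters [0, 2, .., 2m-2] of the standard tableau go to the longer rows of
   the double staircase, any subset of which can be lengthened by one box. *)
Lemma double_stair_chain (lam : intpart) N : ((psize lam).*2 <= N)%N ->
  exists2 c, c \in chains N lam &
    good N (part (double_stair (psize lam))) lam c /\
    forall k, wt lam c k = ((k < (psize lam).*2) && ~~ odd k)%N.
Proof.
set m := psize lam => mN; have [f [f1 f2 f3]] := single_box_chain lam.
rewrite -/m in f1 f2 f3.
(* [uphalf k] is the number of even letters below [k]; the minimum stops the growth after [m]
   letters. *)
pose c := mkseq (fun k => f (minn m (uphalf k))) N.
have cE k : nth lam c k = f (minn m (uphalf k)).
  have [kN|Nk] := ltnP k N; first by rewrite nth_mkseq.
  rewrite nth_default ?size_mkseq // -[LHS]f1; congr f; lia.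
have cc : c \in chains N lam.
  apply/chainsP; split; first by rewrite size_mkseq.
    by rewrite cE minn0; apply: psize_eq0; rewrite f2.
  move=> k _; rewrite !cE; have [e|] := eqVneq (minn m (uphalf k.+1)) (minn m (uphalf k)).
    by rewrite e hstrip_refl.
  move=> /eqP ne; have -> : minn m (uphalf k.+1) = (minn m (uphalf k)).+1 by lia.
  by apply: f3; lia.
have wtE k : wt lam c k = ((k < m.*2) && ~~ odd k)%N.
  rewrite /wt !cE !f2 ?geq_minl //.
  by case: (boolP (_ && _)); lia.
exists c => //; split=> //; apply/asboolP => j k kN; rewrite !part_double_stair.
have := leq_wt_out j k cc; have := leq_wt_out j k.+1 cc; rewrite !wtE.
by case: (boolP (k.+1 < m.*2)%N); case: (boolP (odd k)) => /= ok; lia.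
Qed.

Lemma hall_ss_pos_exists m lam mu : psize lam = m -> psize mu = m ->
  exists2 n, parity_tail m n & 0 < hall n (ss lam n) (ss mu n).
Proof.
move=> lm mm; pose de := double_stair m; pose n := (psize de + m)%N.
(* At least the degree [n], and at least [m.*2] to accommodate the letters up to 2m-2. *)
pose N := (n + m.*2)%N.
have pd : paired de by apply/pairedP => i; rewrite !part_double_stair; congr subn; lia.
have dN : part de N = 0%N by apply: part_psize; rewrite /N /n; lia.
have szde : exists k, psize de = k.*2.
  exists (\sum_(i < m) (m - i))%N; rewrite (@psizeE _ m.*2); last first.
    by rewrite part_double_stair doubleK subnn.
  under eq_bigr do rewrite part_double_stair.
  have H K : (\sum_(i < K.*2) (m - i./2) = (\sum_(i < K) (m - i)).*2)%N.
    elim: K => [|K IH]; first by rewrite !big_ord0.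
    by rewrite doubleS !big_ord_recr /= IH doubleK uphalf_double doubleD -addnA addnn.
  exact: H.
exists n; first by have [k e] := szde; split; rewrite /n; lia.
apply/(@hall_ss_gt0P N); first by rewrite /N leq_addr.
have [|c cc [gc wc]] := @double_stair_chain lam N; first by rewrite lm /N leq_addl.
have [|d dd [gd wd]] := @double_stair_chain mu N; first by rewrite mm /N leq_addl.
rewrite lm in gc wc; rewrite mm in gd wd.
exists (add_wt N de lam c); split.
- by rewrite psize_add_wt // lm.
- by apply/ss_coef_gt0P; exists de, c; rewrite lm.
apply/ss_coef_gt0P; exists de, d; split; rewrite ?mm //.
(* The two weights depend only on [m], so both chains lead from [de] to the same partition. *)
by apply: part_ext => i; rewrite !part_add_wt // wc wd.
Qed.

Theorem theorem4p12 (m : nat) (lam mu : intpart) :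
  psize lam = m -> psize mu = m ->
  exists! n0 : nat,
    [/\ parity_tail m n0,
        forall n, parity_tail m n -> (n < n0)%N ->
          hall n (ss lam n) (ss mu n) = 0
      & forall n, parity_tail m n -> (n0 <= n)%N ->
          0 < hall n (ss lam n) (ss mu n)].
Proof.
move=> lm mm; pose h n := hall n (ss lam n) (ss mu n).
have ex : exists n, `[< parity_tail m n /\ 0 < h n >].
  by have [n tn hn] := hall_ss_pos_exists lm mm; exists n; apply/asboolP.
case: (ex_minnP ex) => n0 /asboolP[t0 h0] min0.
have step n : 0 < h n -> 0 < h n.+2.
  (* With [n + 2] variables, both degrees are computed from the same chains, and [1 < N] holds even
     for [n = 0]. *)
  move=> /(hall_ss_gt0P _ _ (leq_addr 2 n))[nu [sz c1 c2]].
  apply/(@hall_ss_gt0P (n + 2)); first by rewrite addn2.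
  by exists (add11 nu); rewrite psize_add11 sz; split=> //;
    apply: ss_coef_add11 => //; lia.
have up n : parity_tail m n -> (n0 <= n)%N -> 0 < h n.
  move=> [_ en] le; have [_ en0] := t0.
  have -> : n = (n0 + ((n - n0)./2).*2)%N by lia.
  elim: _./2 => [|d IH]; first by rewrite addn0.
  by rewrite doubleS !addnS; apply: step.
(* Below the minimum the product is a natural number that is not positive, hence zero. *)
exists n0; split; first split => // n tn lt.
  apply: contrapT => nz; have hn : 0 < h n.
    rewrite lt_def; apply/andP; split; first exact/eqP.
    by rewrite /h (hall_ss _ _ (leqnn n)) ler0n.
  by have := min0 n (asboolT (conj tn hn)); rewrite leqNgt lt.
move=> n1 [t1 z1 p1]; apply/eqP; rewrite eqn_leq; apply/andP; split.
  by apply: min0; apply/asboolP; split => //; apply: p1.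
rewrite leqNgt; apply/negP => lt.
by have := z1 n0 t0 lt; move: h0; rewrite /h => /[swap] ->; rewrite ltxx.
Qed.
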